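(* Let $f:\mathbb{R}^D\to\mathbb{R}$ be continuous with effective dimension $d_e$, $d_e<D$ and $d_e\le d$, with effective subspace $\mathcal{T}$ and constant subspace $\mathcal{T}^\perp$ spanned by the columns of $U=[I_{d_e}\;0]^T\in\mathbb{R}^{D\times d_e}$ and $V=[0\;I_{D-d_e}]^T\in\mathbb{R}^{D\times(D-d_e)}$, respectively. Let $\boldsymbol{x}^*$ be any global minimizer of $f$ over $\mathcal{X}=[-1,1]^D$, let $\boldsymbol{p}\in\mathcal{X}$ be a given vector, and let $A$ be a $D\times d$ Gaussian matrix. Assume that $\boldsymbol{p}_\top\ne\boldsymbol{x}^*_\top$. Then $$\mathbb{P}[(\mathrm{RP}\mathcal{X})\text{ is successful}]\ \ge\ \mathbb{P}\left[-\boldsymbol{1}-\boldsymbol{p}_{d_e+1:D}\le\boldsymbol{w}\le\boldsymbol{1}-\boldsymbol{p}_{d_e+1:D}\right],$$ where $\boldsymbol{w}$ is a random vector that follows a $(D-d_e)$-dimensional $t$-distribution with parameters $d-d_e+1$ and $\frac{\|\boldsymbol{x}_\top^*-\boldsymbol{p}_\top\|^2}{d-d_e+1}I$.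
   Context: A function $f:\mathbb{R}^D\to\mathbb{R}$ has effective dimension $d_e$ if there is a linear subspace $\mathcal{T}$ of dimension $d_e$ such that $f(\boldsymbol{x}_\top+\boldsymbol{x}_\perp)=f(\boldsymbol{x}_\top)$ for all $\boldsymbol{x}_\top\in\mathcal{T}$ and $\boldsymbol{x}_\perp\in\mathcal{T}^\perp$, and $d_e$ is the smallest integer with this property. $\mathcal{T}$ and $\mathcal{T}^\perp$ are called the effective and constant subspaces of $f$. For $\boldsymbol{x}\in\mathbb{R}^D$, $\boldsymbol{x}_\top=UU^T\boldsymbol{x}$ is the Euclidean projection onto $\mathcal{T}$. $\boldsymbol{p}_{d_e+1:D}$ is the vector of the last $D-d_e$ entries of $\boldsymbol{p}$. A Gaussian matrix is a random matrix with independent $\mathcal{N}(0,1)$ entries. $\|\cdot\|$ is the Euclidean norm, $\boldsymbol{1}$ is the all-ones vector, and vector inequalities are componentwise. Let $f^*=\min_{\boldsymbol{x}\in\mathcal{X}}f(\boldsymbol{x})$. The reduced problem $(\mathrm{RP}\mathcal{X})$ is: minimize $f(A\boldsymbol{y}+\boldsymbol{p})$ over $\boldsymbol{y}\in\mathbb{R}^d$ subject to $A\boldsymbol{y}+\boldsymbol{p}\in\mathcal{X}$. It is successful if there exists $\boldsymbol{y}^*\in\mathbb{R}^d$ with $f(A\boldsymbol{y}^*+\boldsymbol{p})=f^*$ and $A\boldsymbol{y}^*+\boldsymbol{p}\in\mathcal{X}$. An $l$-dimensional random vector has the $t$-distribution with parameters $\nu$ and $\Sigma$ if its density is $\frac{1}{(\pi\nu)^{l/2}}\frac{\Gamma((l+\nu)/2)}{\Gamma(\nu/2)}\det(\Sigma)^{-1/2}\left(1+\frac1\nu\boldsymbol{t}^T\Sigma^{-1}\boldsymbol{t}\right)^{-(l+\nu)/2}$.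 *)

(* Defs.v *)
From HB Require Import structures.
From mathcomp Require Import all_boot all_order all_algebra.
From mathcomp Require Import all_classical all_reals all_analysis.
Import Order.TTheory GRing.Theory Num.Theory.
Import numFieldNormedType.Exports.

Set Implicit Arguments.
Unset Strict Implicit.
Unset Printing Implicit Defensive.

Local Open Scope classical_set_scope.
Local Open Scope ring_scope.

Section linear_algebra.
Context {R : realType}.

(* The library norm on matrices is the sup norm. *)
Definition enorm n (v : 'cV[R]_n) : R := Num.sqrt (\sum_i v i 0 ^+ 2).

(* orthogonal complement of T for the Euclidean inner product *)
Definition orthc n (T : {vspace 'cV[R]_n}) : set 'cV[R]_n :=
  [set x | forall u, u \in T -> \sum_i u i 0 * x i 0 = 0].

Definition colspan n k (M : 'M[R]_(n, k)) : {vspace 'cV[R]_n} :=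
  <<[seq col j M | j <- enum 'I_k]>>%VS.

(* [pid_mx k] of size n x k is [I_k 0]^T when k <= n. *)
Definition Umx (n k : nat) : 'M[R]_(n, k) := pid_mx k.

(* [0 I_(n-k)]^T *)
Definition Vmx (n k : nat) : 'M[R]_(n, n - k) :=
  \matrix_(i, j) ((i == k + j :> nat)%N)%:R.

(* x_top = U U^T x for U = [I_k 0]^T *)
Definition topproj n k (x : 'cV[R]_n) : 'cV[R]_n :=
  Umx n k *m (Umx n k)^T *m x.

Lemma tail_ord_subproof n k (j : 'I_(n - k)) : (k + j < n)%N.
Proof. by rewrite -ltn_subRL. Qed.

Definition tail_ord n k (j : 'I_(n - k)) : 'I_n :=
  Ordinal (tail_ord_subproof j).

Definition tailv n k (v : 'cV[R]_n) : 'cV[R]_(n - k) :=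
  \col_j v (tail_ord j) 0.

End linear_algebra.

Section effective_dimension.
Context {R : realType} {D : nat}.
Implicit Types (f : 'cV[R]_D -> R) (T : {vspace 'cV[R]_D}).

Definition constant_along_orthc f T :=
  forall xt xp, xt \in T -> orthc T xp -> f (xt + xp) = f xt.

Definition effective_dimension f (de : nat) :=
  (exists T, \dim T = de /\ constant_along_orthc f T) /\
  (forall T, constant_along_orthc f T -> (de <= \dim T)%N).

Definition effective_subspace f (de : nat) T :=
  [/\ effective_dimension f de, \dim T = de & constant_along_orthc f T].

End effective_dimension.

Section optimization.
Context {R : realType} {D : nat}.
Implicit Types (f : 'cV[R]_D -> R) (X : set 'cV[R]_D).

Definition box : set 'cV[R]_D := [set x | forall i, -1 <= x i 0 <= 1].

Definition global_minimizer f X (x : 'cV[R]_D) :=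
  X x /\ forall z, X z -> f x <= f z.

Definition minimum_value f X (m : R) :=
  (exists2 x, X x & f x = m) /\ forall z, X z -> m <= f z.

Definition RPX_successful d f X (m : R) (A : 'M[R]_(D, d)) (p : 'cV[R]_D) :=
  exists y : 'cV[R]_d, f (A *m y + p) = m /\ X (A *m y + p).

End optimization.

Section random_matrices.
Context {d0} {Omega : measurableType d0} {R : realType}.
Variable P : probability Omega R.

Definition mutually_independent (I : finType) (Z : I -> {RV P >-> R}) :=
  forall (J : {set I}) (B : I -> set R), (forall i, measurable (B i)) ->
    P [set w | forall i, i \in J -> B i (Z i w)] =
    (\prod_(i in J) P (Z i @^-1` B i))%E.

Definition gaussian_matrix D d (A : 'I_D -> 'I_d -> {RV P >-> R}) :=
  (forall i j (B : set R), measurable B ->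
     distribution P (A i j) B = normal_prob 0 1 B) /\
  mutually_independent (fun ij : 'I_D * 'I_d => A ij.1 ij.2).

Definition sample_matrix D d (A : 'I_D -> 'I_d -> {RV P >-> R}) (w : Omega) :
  'M[R]_(D, d) := \matrix_(i, j) A i j w.

End random_matrices.
Arguments mutually_independent {d0 Omega R} P {I} Z.
Arguments gaussian_matrix {d0 Omega R} P {D d} A.

(* n-dimensional Lebesgue measure, carried by n-tuples since matrices have no
   canonical measurable structure: the unit mass for n = 0, and the image of
   the product of the one-dimensional and the n-dimensional Lebesgue measures
   by cons for n + 1. *)
Section lebesgue_tuple.
Context {R : realType}.

Definition tuple_cons n (xt : measurableTypeR R * n.-tuple R) : n.+1.-tuple R :=
  [the n.+1.-tuple R of xt.1 :: xt.2].

Lemma measurable_tuple_cons n : measurable_fun setT (@tuple_cons n).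
Proof. exact: measurable_cons. Qed.

Section lebesgue_cons.
Context (n : nat).
Variable mu : {sigma_finite_measure set (n.-tuple R) -> \bar R}.

Definition lebesgue_cons : set (n.+1.-tuple R) -> \bar R :=
  pushforward (lebesgue_measure \x mu)%E (@tuple_cons n).

Lemma lebesgue_cons0 : lebesgue_cons set0 = 0%E.
Proof. by rewrite /lebesgue_cons /pushforward preimage_set0 measure0. Qed.

Lemma lebesgue_cons_ge0 A : (0 <= lebesgue_cons A)%E.
Proof. by rewrite /lebesgue_cons /pushforward; exact: measure_ge0. Qed.

Lemma lebesgue_cons_sigma_additive : semi_sigma_additive lebesgue_cons.
Proof.
have mcons (A : set (n.+1.-tuple R)) :
    measurable A -> measurable (@tuple_cons n @^-1` A).
  by move=> mA; rewrite -[X in measurable X]setTI; exact: measurable_tuple_cons.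
move=> F mF tF mUF; rewrite /lebesgue_cons /pushforward preimage_bigcup.
apply: measure_semi_sigma_additive.
- by move=> k; exact: mcons.
- apply/trivIsetP => /= i j _ _ ij; rewrite -preimage_setI.
  by move/trivIsetP : tF => /(_ _ _ _ _ ij) ->//; rewrite preimage_set0.
- by rewrite -preimage_bigcup; exact: mcons.
Qed.

HB.instance Definition _ := isMeasure.Build _ _ _ lebesgue_cons
  lebesgue_cons0 lebesgue_cons_ge0 lebesgue_cons_sigma_additive.

Lemma sigma_finite_lebesgue_cons : sigma_finite setT lebesgue_cons.
Proof.
have /sigma_finiteP[F [TF ndF Foo]] := sigma_finiteT (@lebesgue_measure R).
have /sigma_finiteP[G [TG ndG Goo]] := sigma_finiteT mu.
pose g (t : n.+1.-tuple R) : measurableTypeR R * n.-tuple R :=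
  (thead t, [tuple of behead t]).
have mg : measurable_fun setT g.
  apply: measurable_fun_pair; last exact: measurable_behead.
  exact: measurable_tnth.
have gK (xt : measurableTypeR R * n.-tuple R) : g (tuple_cons xt) = xt.
  by case: xt => x t; rewrite /g /tuple_cons /=; congr pair; exact: val_inj.
exists (fun k => g @^-1` (F k `*` G k)).
  rewrite -preimage_bigcup predeqE => t; split=> // _ /=.
  have [i _ Fi] : (\bigcup_k F k) (g t).1 by rewrite -TF.
  have [j _ Gj] : (\bigcup_k G k) (g t).2 by rewrite -TG.
  exists (maxn i j) => //; split.
  - by move: Fi; exact/subsetPset/ndF/leq_maxl.
  - by move: Gj; exact/subsetPset/ndG/leq_maxr.
move=> k; have [mF Fk] := Foo k; have [mG Gk] := Goo k; split.
  by rewrite -[X in measurable X]setTI; apply: mg => //; exact: measurableX.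
rewrite /lebesgue_cons /pushforward -comp_preimage.
rewrite (_ : g \o _ = id) ?preimage_id; last by apply/funext => xt; exact: gK.
by rewrite product_measure1E// lte_mul_pinfty// ge0_fin_numE.
Qed.

HB.instance Definition _ := Measure_isSigmaFinite.Build _ _ _ lebesgue_cons
  sigma_finite_lebesgue_cons.

End lebesgue_cons.

Fixpoint lebesgue_tuple (n : nat) :
    {sigma_finite_measure set (n.-tuple R) -> \bar R} :=
  if n is n'.+1
  then lebesgue_cons (lebesgue_tuple n')
  else dirac [tuple].

End lebesgue_tuple.

Section t_distribution.
Context {R : realType}.

Definition Gamma (a : R) : R :=
  \int[lebesgue_measure]_(x in `]0, +oo[) (x `^ (a - 1) * expR (- x)).

Definition t_pdf l (nu : R) (Sigma : 'M[R]_l) (t : 'cV[R]_l) : R :=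
  ((pi * nu) `^ (l%:R / 2))^-1 * (Gamma ((l%:R + nu) / 2) / Gamma (nu / 2)) *
  (\det Sigma) `^ (- (1 / 2)) *
  (1 + 1 / nu * (t^T *m invmx Sigma *m t) 0 0) `^ (- ((l%:R + nu) / 2)).

Definition tuple_col l (t : l.-tuple R) : 'cV[R]_l := \col_i tnth t i.

Definition has_t_distribution {d0} {Omega : measurableType d0}
    (P : probability Omega R) l (W : {RV P >-> l.-tuple R})
    (nu : R) (Sigma : 'M[R]_l) :=
  forall B : set (l.-tuple R), measurable B ->
    distribution P W B =
    (\int[lebesgue_tuple l]_(t in B) (t_pdf nu Sigma (tuple_col t))%:E)%E.

End t_distribution.
Arguments has_t_distribution {R d0 Omega} P {l} W nu Sigma.

(* Main.v *)
Require Import Defs.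
From HB Require Import structures.
From mathcomp Require Import all_boot all_order all_algebra.
From mathcomp Require Import all_classical all_reals all_analysis.
From mathcomp Require Import measurable_realfun.
From mathcomp Require Import ring lra.
Import Order.TTheory GRing.Theory Num.Theory.
Import numFieldNormedType.Exports.

(* Write z for x*_top - p_top.  The problem is solved by every y such that
   (A y)_top = z and -1 - p_j <= (A y)_j <= 1 - p_j for the other rows.
   Multiplying A by fixed orthogonal matrices on either side does not change its
   law: by independence it is enough to rotate two coordinates of a standard
   normal vector, and a plane rotation is a product of three shears, which
   preserve Lebesgue measure.
   A rotation of the rows turns z into r e_k with r^2 = |z|^2.  Conditioning on a
   row on which A y has to vanish, a rotation of the columns makes this row
   vanish outside one column; dropping that row and that column can only decrease
   the probability.  After d_e - 1 such steps a single constrained row v of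
   length n = d - d_e + 1 is left, and rotating v onto an axis yields the solution
   A y = (r / |v|) g on the m = D - d_e remaining rows, with g standard normal
   and independent of v.
   The law of (r / |v|) g has a density proportional to
   (1 + |t|^2 / r^2)^(-(m + n) / 2): given v it has a normal density, and the
   scaling v |-> (1 + |t|^2 / r^2)^(-1/2) v absorbs the dependence on t of the
   integral over v.  The constant, and hence the Gamma factors, need not be
   computed, since both densities have integral 1. *)

Set Implicit Arguments.
Unset Strict Implicit.
Unset Printing Implicit Defensive.

Local Open Scope classical_set_scope.
Local Open Scope ring_scope.

(** * Densities, Lebesgue measure and plane rotations *)

Section density.
Context d (T : measurableType d) (R : realType).
Variables mu nu : {measure set T -> \bar R}.
Variable g : T -> R.
Hypothesis mg : measurable_fun setT g.
Hypothesis g0 : forall x, 0 <= g x.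
Hypothesis nuE :
  forall A, measurable A -> nu A = (\int[mu]_(x in A) (g x)%:E)%E.
Local Open Scope ereal_scope.
Import HBNNSimple.

(** Indicators are the hypothesis [nuE], simple functions follow by linearity, and monotone
    convergence along [nnsfun_approx] reaches [f]. *)
Lemma ge0_integral_density (f : T -> \bar R) : measurable_fun setT f ->
  (forall x, 0 <= f x) -> \int[nu]_x f x = \int[mu]_x (f x * (g x)%:E).
Proof.
move=> mf f0; pose h := nnsfun_approx measurableT mf.
have indicE (A : set T) : measurable A ->
    nu A = \int[mu]_x ((\1_A x)%:E * (g x)%:E).
  move=> mA; rewrite nuE// integral_mkcond; apply: eq_integral => x _.
  rewrite /= patchE indicE; case: ifPn => xA; first by rewrite mul1e.
  by rewrite mul0e.
have hE n : \int[nu]_x (h n x)%:E = \int[mu]_x ((h n x)%:E * (g x)%:E).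
  under eq_integral do rewrite fimfunE -fsumEFin//.
  rewrite ge0_integral_fsum//; last 2 first.
    by move=> r; exact/measurable_EFinP/measurable_funM.
    by move=> r x _; rewrite nnfun_muleindic_ge0.
  under eq_fsbigr do rewrite integralZl_indic_nnsfun//= integral_indic// setIT.
  under [RHS]eq_integral => x _.
    rewrite fimfunE -fsumEFin// ge0_mule_fsuml; last first.
      by move=> r; rewrite nnfun_muleindic_ge0.
    over.
  rewrite ge0_integral_fsum//; last 2 first.
  - move=> r; apply: emeasurable_funM; last exact/measurable_EFinP.
    exact/measurable_EFinP/measurable_funM.
  - by move=> r x _; rewrite mule_ge0 ?nnfun_muleindic_ge0 ?lee_fin.
  apply: eq_fsbigr => r; rewrite inE => -[x _ <-].
  rewrite indicE//.
  under [RHS]eq_integral do rewrite EFinM -muleA.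
  rewrite ge0_integralZl//.
  - by apply: emeasurable_funM; apply/measurable_EFinP => //; exact: measurable_indic.
  - by move=> y _; rewrite mule_ge0 ?lee_fin.
  - by rewrite lee_fin.
transitivity (limn (fun n => \int[nu]_x (h n x)%:E)).
  rewrite -monotone_convergence//.
  - by apply: eq_integral => y _; apply/esym/cvg_lim => //; exact: cvg_nnsfun_approx.
  - by move=> n; exact/measurable_EFinP.
  - by move=> n y _; rewrite lee_fin.
  - by move=> y _ m n mn; rewrite lee_fin; exact/lefP/nd_nnsfun_approx.
under eq_fun do rewrite hE.
rewrite -monotone_convergence//.
- apply: eq_integral => y _; apply/cvg_lim => //.
  by apply: cvgeZr => //; exact: cvg_nnsfun_approx.
- by move=> n; apply: emeasurable_funM; exact/measurable_EFinP.
- by move=> n y _; rewrite mule_ge0 ?lee_fin.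
- move=> y _ m n mn; rewrite lee_wpmul2r ?lee_fin//.
  exact/lefP/nd_nnsfun_approx.
Qed.

End density.


Section image_measure.
Context d d' (T1 : measurableType d) (T2 : measurableType d') (R : realType).

Definition image_measure (m : {measure set T1 -> \bar R}) (f : T1 -> T2)
    (mf : measurable_fun setT f) : {measure set T2 -> \bar R} :=
  measure_function_pushforward__canonical__measure_function_Measure m mf.

Lemma ge0_integral_image (m : {measure set T1 -> \bar R}) (f : T1 -> T2)
    (mf : measurable_fun setT f) (h : T2 -> \bar R) :
  measurable_fun setT h -> (forall y, 0 <= h y)%E ->
  (\int[image_measure m mf]_y h y = \int[m]_x h (f x))%E.
Proof. by move=> mh h0; rewrite ge0_integral_pushforward//= preimage_setT. Qed.

Lemma integral_measure_eq (m m' : {measure set T1 -> \bar R})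
    (h : T1 -> \bar R) : (forall A, measurable A -> m A = m' A) ->
  (\int[m]_x h x = \int[m']_x h x)%E.
Proof. by move=> mm'; apply: eq_measure_integral => A mA _; exact: mm'. Qed.

End image_measure.

Section lebesgue_affine.
Context {R : realType}.
Local Notation mu := (@lebesgue_measure R).

Lemma measurable_affine (a b : R) :
  measurable_fun setT (fun x : measurableTypeR R => a * x + b : measurableTypeR R).
Proof. by apply: measurable_funD => //; exact: measurable_funM. Qed.

(** By uniqueness of Lebesgue measure it suffices to compare both sides on half-open intervals,
    whose preimages are again half-open intervals. *)
Lemma lebesgue_measure_affine (a b : R) (A : set (measurableTypeR R)) : 0 < a ->
  measurable A -> (mu A = a%:E * mu ((fun x => (a * x + b)%R) @^-1` A))%E.
Proof.
move=> a0 mA.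
apply: (@lebesgue_measure_unique R
  (mscale (NngNum (ltW a0)) (image_measure mu (measurable_affine a b)))) => //.
move=> _ [[l r] _ <-] /=; rewrite /mscale /= /pushforward.
have -> : (fun x => a * x + b) @^-1` `]l, r] = `](l - b) / a, (r - b) / a]%classic.
  apply/funext => x; apply/propext; rewrite /= !in_itv/= ltr_pdivrMr// ler_pdivlMr//.
  by rewrite ltrBlDr lerBrDr (mulrC x).
rewrite !lebesgue_measure_itv/= !lte_fin.
rewrite ltr_pM2r ?invr_gt0// ltrD2r; case: ifPn => lr; last by rewrite mule0.
rewrite -!EFinB -EFinM; congr EFin.
by rewrite -mulrBl mulrC divfK ?gt_eqF//; ring.
Qed.

(** A negative slope is reduced to a positive one by the invariance of Lebesgue measure under
    reflection. *)
Lemma integral_lebesgue_affine (a b : R) (f : measurableTypeR R -> \bar R) :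
  a != 0 -> measurable_fun setT f -> (forall x, 0 <= f x)%E ->
  (\int[mu]_x f x = `|a|%:E * \int[mu]_x f (a * x + b)%R)%E.
Proof.
move=> a0.
wlog: a b f a0 / 0 < a.
  move=> H mf f0; have [a1|a1|a1] := ltgtP a 0; last first.
  - by rewrite a1 eqxx in a0.
  - exact: H.
  have mopp : measurable_fun setT (fun x : measurableTypeR R => - x : measurableTypeR R).
    exact: measurable_funN.
  transitivity (\int[image_measure mu mopp]_x f x)%E.
    by apply: integral_measure_eq => A mA; exact/esym/lebesgue_measureN.
  rewrite ge0_integral_image// [LHS](H (- a) (- b)) ?oppr_eq0 ?oppr_gt0//; last first.
    exact: measurableT_comp.
  rewrite normrN; congr (_ * _)%E; apply: eq_integral => x _.
  by congr f; ring.
move=> {}a0 mf f0.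
transitivity (\int[mscale (NngNum (ltW a0))
  (image_measure mu (measurable_affine a b))]_x f x)%E.
  by apply: integral_measure_eq => A mA; exact: lebesgue_measure_affine.
by rewrite ge0_integral_mscale// ge0_integral_image// gtr0_norm.
Qed.

End lebesgue_affine.

Section rotation.
Context {R : realType}.
Local Notation mu := (@lebesgue_measure R).
Local Notation RR := (measurableTypeR R).
Implicit Type F : RR * RR -> \bar R.

Let lebesgue_swap F : measurable_fun setT F -> (forall z, 0 <= F z)%E ->
  (\int[mu]_x \int[mu]_y F (x, y) = \int[mu]_y \int[mu]_x F (x, y))%E.
Proof. by move=> mF F0; exact: (@fubini_tonelli _ _ _ _ _ mu mu F mF F0). Qed.

(** Once Tonelli puts the integral over [x] inside, the shear is for each fixed [y] a translation by
    [t * y]. *)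
Lemma integral_shear1 (t : R) F : measurable_fun setT F -> (forall z, 0 <= F z)%E ->
  (\int[mu]_x \int[mu]_y F ((x + t * y)%R, y) = \int[mu]_x \int[mu]_y F (x, y))%E.
Proof.
move=> mF F0.
have mG : measurable_fun setT (fun z : RR * RR => (z.1 + t * z.2, z.2) : RR * RR).
  apply: measurable_fun_pair => //; apply: measurable_funD => //.
  exact: measurable_funM.
rewrite (lebesgue_swap (measurableT_comp mF mG) (fun z => F0 _)) /=.
rewrite (lebesgue_swap mF F0); apply: eq_integral => y _.
rewrite [RHS](@integral_lebesgue_affine _ 1 (t * y))//; last exact: measurableT_comp.
rewrite normr1 mul1e; apply: eq_integral => x _; congr (F (_, _)).
by rewrite mul1r.
Qed.

Lemma integral_shear2 (t : R) F : measurable_fun setT F -> (forall z, 0 <= F z)%E ->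
  (\int[mu]_x \int[mu]_y F (x, (y + t * x)%R) = \int[mu]_x \int[mu]_y F (x, y))%E.
Proof.
move=> mF F0; apply: eq_integral => x _.
rewrite [RHS](@integral_lebesgue_affine _ 1 (t * x))//; last exact: measurableT_comp.
rewrite normr1 mul1e; apply: eq_integral => y _; congr (F (_, _)).
by rewrite mul1r.
Qed.

(* A rotation that is not a multiple of the identity is a product of three shears. *)
Lemma integral_rotation (c s : R) F : s != 0 -> c ^+ 2 + s ^+ 2 = 1 ->
  measurable_fun setT F -> (forall z, 0 <= F z)%E ->
  (\int[mu]_x \int[mu]_y F ((c * x + s * y)%R, (- s * x + c * y)%R) =
   \int[mu]_x \int[mu]_y F (x, y))%E.
Proof.
(* For an angle with cosine [c] and sine [s], [t] is the tangent of the half angle; the three shears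
   have factors [t], [- s] and [t]. *)
move=> s0 cs1 mF F0; pose t := (1 - c) / s.
have ts : t * s = 1 - c by rewrite /t divfK.
have tc : t * (1 + c) = s.
  by apply: (mulIf s0); rewrite mulrAC ts -expr2 -[s ^+ 2](addKr (c ^+ 2)) cs1; ring.
have mpair (f g : RR * RR -> RR) : measurable_fun setT f -> measurable_fun setT g ->
  measurable_fun setT (fun z : RR * RR => F (f z, g z)).
  by move=> mf mg; apply: measurableT_comp => //; exact: measurable_fun_pair.
have mlin (a b : R) : measurable_fun setT (fun z : RR * RR => a * z.1 + b * z.2 : RR).
  by apply: measurable_funD => //; exact: measurable_funM.
have mlin1 (a : R) : measurable_fun setT (fun z : RR * RR => z.1 + a * z.2 : RR).
  by apply: measurable_funD => //; exact: measurable_funM.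
have mlin2 (a : R) : measurable_fun setT (fun z : RR * RR => z.2 + a * z.1 : RR).
  by apply: measurable_funD => //; exact: measurable_funM.
have m1 := mpair _ _ (mlin1 t) measurable_snd.
have m2 : measurable_fun setT (fun z : RR * RR =>
    F (z.1 + t * (z.2 + - s * z.1), z.2 + - s * z.1)).
  apply: (mpair (fun z => z.1 + t * (z.2 + - s * z.1))
    (fun z => z.2 + - s * z.1)) => //.
  by apply: measurable_funD => //; apply: measurable_funM => //; exact: mlin2.
rewrite -(integral_shear1 t mF F0) -(integral_shear2 (- s) m1 (fun z => F0 _)).
rewrite -(integral_shear1 t m2 (fun z => F0 _)) /=.
apply: eq_integral => x _; apply: eq_integral => y _; congr (F (_, _)).
  transitivity ((1 - t * s) * x + (t * (1 + (1 - t * s))) * y); last by ring.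
  by rewrite ts subKr tc.
transitivity (- s * x + (1 - t * s) * y); last by ring.
by rewrite ts subKr.
Qed.

End rotation.

Lemma product_measure1_integral d1 d2 (T1 : measurableType d1)
    (T2 : measurableType d2) (R : realType)
    (m1 : {sigma_finite_measure set T1 -> \bar R})
    (m2 : {sigma_finite_measure set T2 -> \bar R}) A : measurable A ->
  ((m1 \x m2) A = \int[m1]_x \int[m2]_y (\1_A (x, y))%:E)%E.
Proof.
move=> mA; rewrite -(fubini_tonelli1 (fun z => (\1_A z)%:E))//=.
  by rewrite integral_indic// setIT.
by apply/measurable_EFinP; exact: measurable_indic.
Qed.

Section gauss.
Context {R : realType}.
Local Notation mu := (@lebesgue_measure R).
Local Notation RR := (measurableTypeR R).
Local Notation N01 := (@normal_prob R 0 1).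
Local Notation phi := (@normal_pdf R 0 1).

Lemma measurable_phi : measurable_fun setT (phi : RR -> RR).
Proof. exact: measurable_normal_pdf. Qed.

Lemma phiE x : phi x = normal_peak 1 * expR (- (x ^+ 2) / 2).
Proof.
by rewrite normal_pdfE ?oner_eq0// /normal_fun subr0 expr1n.
Qed.

Lemma ge0_integral_normal (f : RR -> \bar R) : measurable_fun setT f ->
  (forall x, 0 <= f x)%E -> (\int[N01]_x f x = \int[mu]_x (f x * (phi x)%:E))%E.
Proof.
move=> mf f0; apply: ge0_integral_density => //; first exact: measurable_phi.
by move=> x; exact: normal_pdf_ge0.
Qed.

Let g (z : RR * RR) : R := normal_peak 1 ^+ 2 * expR (- (z.1 ^+ 2 + z.2 ^+ 2) / 2).

Let normal_prod2E (A : set (RR * RR)) : measurable A ->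
  ((N01 \x N01) A = \int[mu]_x \int[mu]_y ((\1_A (x, y))%:E * (g (x, y))%:E))%E.
Proof.
move=> mA.
have mf : measurable_fun setT (fun z : RR * RR => (\1_A z)%:E : \bar R).
  by apply/measurable_EFinP; exact: measurable_indic.
rewrite product_measure1_integral; last exact: mA.
rewrite ge0_integral_normal; last 2 first.
- exact: (measurable_fun_fubini_tonelli_F _ mf).
- by move=> x; apply: integral_ge0.
apply: eq_integral => x _; rewrite ge0_integral_normal; last 2 first.
- exact: measurableT_comp mf _.
- by [].
rewrite -ge0_integralZr; last 4 first.
- exact: measurableT.
- apply: emeasurable_funM; first exact: measurableT_comp mf _.
  by apply/measurable_EFinP; exact: measurable_phi.
- by move=> y _; rewrite mule_ge0// lee_fin normal_pdf_ge0.
- by rewrite lee_fin normal_pdf_ge0.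
apply: eq_integral => y _; rewrite -muleA -(EFinM (phi y)); congr (_ * _%:E)%E.
by rewrite /g !phiE mulrACA -expr2 -expRD; congr (_ * expR _) => /=; ring.
Qed.

(** The joint density [g] depends only on the squared radius, which the rotation leaves unchanged,
    and [integral_rotation] handles Lebesgue measure. *)
Lemma normal_rotation (c s : R) (S : set (RR * RR)) :
  s != 0 -> c ^+ 2 + s ^+ 2 = 1 -> measurable S ->
  ((N01 \x N01) ((fun z => ((c * z.1 + s * z.2)%R, (- s * z.1 + c * z.2)%R)) @^-1` S)
   = (N01 \x N01) S)%E.
Proof.
move=> s0 cs1 mS.
have mrot : measurable_fun setT
  (fun z : RR * RR => (c * z.1 + s * z.2, - s * z.1 + c * z.2) : RR * RR).
  by apply: measurable_fun_pair => /=; apply: measurable_funD;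
    exact: measurable_funM.
have mS' : measurable
    ((fun z : RR * RR => (c * z.1 + s * z.2, - s * z.1 + c * z.2)) @^-1` S).
  by rewrite -[X in measurable X]setTI; exact: mrot.
rewrite normal_prod2E; last exact: mS'.
rewrite normal_prod2E; last exact: mS.
pose F (z : RR * RR) := ((\1_S z)%:E * (g z)%:E)%E.
rewrite -[RHS](integral_rotation (F := F) s0 cs1); last 2 first.
- apply: emeasurable_funM; first by apply/measurable_EFinP; exact: measurable_indic.
  apply/measurable_EFinP; apply: measurable_funM => //.
  apply: measurableT_comp => //; apply: measurable_funM => //.
  apply: measurableT_comp => //; apply: measurable_funD => //;
    exact: measurable_funX.
- by move=> z; rewrite mule_ge0// lee_fin mulr_ge0 ?expR_ge0 ?sqr_ge0.
apply: eq_integral => x _; apply: eq_integral => y _; rewrite /F /g/=.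
congr (_ * (_ * expR (- _ / 2))%:E)%E.
transitivity ((c ^+ 2 + s ^+ 2) * (x ^+ 2 + y ^+ 2)); last by ring.
by rewrite cs1 mul1r.
Qed.

End gauss.

(** * Gaussian matrices *)

Lemma measurable_preimageT d d' (T : measurableType d) (T' : measurableType d')
    (f : T -> T') (B : set T') :
  measurable_fun setT f -> measurable B -> measurable (f @^-1` B).
Proof. by move=> mf mB; rewrite -[X in measurable X]setTI; exact: mf. Qed.

Section gaussian_mx.
Context {R : realType}.
Local Notation RR := (measurableTypeR R).
Local Notation N01 := (@normal_prob R 0 1).

(** One product formula encodes both independence and the N(0,1) marginals: taking [setT] for the
    other entries recovers every subfamily. It concerns an arbitrary matrix-valued map, so that it
    can be restated directly for products, transposes and submatrices. *)
Definition gaussian_mx d (T : measurableType d) (P : probability T R) m n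
    (X : T -> 'M[R]_(m, n)) :=
  (forall i j, measurable_fun setT (fun w => X w i j : RR)) /\
  (forall B : 'I_m -> 'I_n -> set RR, (forall i j, measurable (B i j)) ->
    P [set w | forall i j, B i j (X w i j)] =
    (\prod_i \prod_j N01 (B i j))%E).

Lemma measurable_rect d (T : measurableType d) m n (X : T -> 'M[R]_(m, n))
    (B : 'I_m -> 'I_n -> set RR) :
  (forall i j, measurable_fun setT (fun w => X w i j : RR)) ->
  (forall i j, measurable (B i j)) ->
  measurable [set w | forall i j, B i j (X w i j)].
Proof.
move=> mX mB; rewrite (_ : mkset _ =
  \bigcap_(p in [set: 'I_m * 'I_n]) ((fun w => X w p.1 p.2) @^-1` B p.1 p.2)).
  apply: fin_bigcap_measurable => // p _.
  exact: (measurable_preimageT (mX p.1 p.2) (mB _ _)).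
apply/seteqP; split => w /= H; first by move=> p _; exact: H.
by move=> i j; exact: (H (i, j)).
Qed.

Section one_space.
Context d (T : measurableType d) (P : probability T R).

Lemma gaussian_mx_tr m n (X : T -> 'M[R]_(m, n)) :
  gaussian_mx P X -> gaussian_mx P (fun w => (X w)^T).
Proof.
move=> [mX PX]; split=> [i j|B mB].
  by under eq_fun do rewrite mxE; exact: mX.
rewrite exchange_big/= -PX//; congr (P _).
by apply/seteqP; split => w H i j; have := H j i; rewrite !mxE.
Qed.

(** The entries are arranged for multiplication on the right, which mixes the columns [a] and [b] of
    a matrix and fixes the others. *)
Definition givens n (a b : 'I_n) (c s : R) : 'M[R]_n :=
  \matrix_(i, j) if j == a then c * (i == a)%:R + s * (i == b)%:R
                 else if j == b then - s * (i == a)%:R + c * (i == b)%:R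
                 else (i == j)%:R.

Lemma sum_mul_delta n (x : 'I_n -> R) a : \sum_i x i * (i == a)%:R = x a.
Proof.
rewrite (bigD1 a)//= eqxx mulr1 big1 ?addr0// => i /negPf ->.
by rewrite mulr0.
Qed.

Lemma mul_givens m n (X : 'M[R]_(m, n)) a b c s i j :
  (X *m givens a b c s) i j =
  if j == a then c * X i a + s * X i b
  else if j == b then - s * X i a + c * X i b else X i j.
Proof.
rewrite mxE; have [ja|ja] := boolP (j == a).
  under eq_bigr do rewrite mxE ja mulrDr !(mulrCA (X _ _)).
  by rewrite big_split/= -!mulr_sumr !sum_mul_delta.
have [jb|jb] := boolP (j == b).
  under eq_bigr do rewrite mxE (negPf ja) jb mulrDr !(mulrCA (X _ _)).
  by rewrite big_split/= -!mulr_sumr !sum_mul_delta.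
under eq_bigr do rewrite mxE (negPf ja) (negPf jb).
by rewrite sum_mul_delta.
Qed.

(** Within a single row only two independent entries change. On the event that the remaining entries
    lie in their sets, the law of this pair is a multiple of a rotation-invariant measure. *)
Lemma gaussian_mx_givens_row m n (X : T -> 'M[R]_(m, n)) i0 a b c s :
  a != b -> s != 0 -> c ^+ 2 + s ^+ 2 = 1 -> gaussian_mx P X ->
  gaussian_mx P (fun w => \matrix_(i, j)
    if i == i0 then (X w *m givens a b c s) i j else X w i j).
Proof.
move=> ab s0 cs1 [mX PX]; split=> [i j|B mB].
  under eq_fun do rewrite mxE.
  have [_|_] := eqVneq i i0; last exact: mX.
  under eq_fun do rewrite mul_givens.
  have [_|ja] := eqVneq j a.
    by apply: measurable_funD; apply: measurable_funM => //; exact: mX.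
  have [_|_] := eqVneq j b; last exact: mX.
  by apply: measurable_funD; apply: measurable_funM => //; exact: mX.
(* [rest] leaves the two rotated entries free, [B3] constrains them by [S1] and [S2], and [D] is the
   event that concerns only the other entries. *)
pose rest i j := if (i, j) \in [:: (i0, a); (i0, b)] then setT else B i j.
pose B3 (S1 S2 : set RR) i j :=
  if (i, j) == (i0, a) then S1 else if (i, j) == (i0, b) then S2 else B i j.
pose D := [set w | forall i j, rest i j (X w i j)].
have mrest i j : measurable (rest i j) by rewrite /rest; case: ifP.
have mD : measurable D by exact: measurable_rect.
have mB3 S1 S2 : measurable S1 -> measurable S2 -> forall i j, measurable (B3 S1 S2 i j).
  by move=> mS1 mS2 i j; rewrite /B3; case: ifP => // _; case: ifP.
pose Y w : RR * RR := (X w i0 a, X w i0 b).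
have mY : measurable_fun setT Y by exact: measurable_fun_pair.
have PB3 S1 S2 : measurable S1 -> measurable S2 ->
    P [set w | forall i j, B3 S1 S2 i j (X w i j)] =
    (N01 S1 * N01 S2 * \prod_(p | (p != (i0, a)) && (p != (i0, b))) N01 (B p.1 p.2))%E.
  move=> mS1 mS2; rewrite PX; last exact: mB3.
  rewrite pair_bigA/= (bigD1 (i0, a))//= (bigD1 (i0, b))/=; last first.
    by rewrite xpair_eqE eqxx/= eq_sym.
  rewrite muleA; congr (_ * _ * _)%E.
  - by rewrite /B3 eqxx.
  - by rewrite /B3 xpair_eqE eqxx/= eq_sym (negPf ab) eqxx.
  - apply: eq_bigr => -[i j] /= /andP[ija ijb].
    by rewrite /B3 (negPf ija) (negPf ijb).
set k := (\prod_(p | _) _)%E in PB3.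
have B3E S1 S2 : [set w | forall i j, B3 S1 S2 i j (X w i j)] =
    Y @^-1` (S1 `*` S2) `&` D.
  apply/seteqP; split => w /=.
    move=> H; split.
      split; first by have := H i0 a; rewrite /B3 eqxx.
      by have := H i0 b; rewrite /B3 xpair_eqE eqxx/= eq_sym (negPf ab) eqxx.
    move=> i j; have := H i j; rewrite /B3 /rest !inE.
    by case: ifP => //; case: ifP.
  move=> [[H1 H2] HD] i j; have := HD i j; rewrite /B3 /rest !inE.
  have [[-> ->]//|ija] := eqVneq (i, j) (i0, a).
  by have [[-> ->]//|ijb] := eqVneq (i, j) (i0, b).
have PD : P D = k.
  have := PB3 setT setT measurableT measurableT.
  by rewrite B3E setXTT preimage_setT setTI !probability_setT !mul1e.
have k0 : 0 <= fine k by rewrite fine_ge0// -PD.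
have kE : k = (fine k)%:E by rewrite fineK// -PD fin_num_measure.
(* The law of the pair [Y] on the event [D] is left unnormalized, so that the case where [D] has
   probability 0 needs no separate treatment. *)
pose m' := image_measure (mrestr P mD) mY.
pose m1 : {sigma_finite_measure set RR -> \bar R} := mscale (NngNum k0) N01.
have m'E S : measurable S -> m' S = (k * (N01 \x N01) S)%E.
  move=> mS; rewrite -(@product_measure_unique _ _ _ _ _ m1 N01 m')//.
    rewrite /product_measure1 /m1 ge0_integral_mscale//=.
      by rewrite -kE.
    exact: measurable_fun_xsection.
  move=> S1 S2 mS1 mS2.
  rewrite /m' /= /pushforward/= /mrestr -B3E PB3//.
  by rewrite /m1 /= /mscale/= -kE muleC muleA.
pose rot (z : RR * RR) : RR * RR := (c * z.1 + s * z.2, - s * z.1 + c * z.2).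
have mrot : measurable_fun setT rot.
  by apply: measurable_fun_pair => /=; apply: measurable_funD;
    exact: measurable_funM.
have mBB : measurable (B i0 a `*` B i0 b) by exact: measurableX.
(* The rotation acts on [Y] alone and [D] does not see it, so the event is a preimage under [rot]
   intersected with [D]. *)
transitivity (m' (rot @^-1` (B i0 a `*` B i0 b))).
  rewrite /m' /= /pushforward/= /mrestr; congr (P _).
  apply/seteqP; split => w /=.
    move=> H; split.
      split=> /=.
        by have := H i0 a; rewrite mxE eqxx mul_givens eqxx.
      by have := H i0 b; rewrite mxE eqxx mul_givens eq_sym (negPf ab) eqxx.
    move=> i j; rewrite /rest !inE; case: ifPn => // /norP[ija ijb].
    have := H i j; rewrite mxE; have [ii0|//] := eqVneq i i0.
    rewrite mul_givens; move: ija ijb; rewrite ii0 !xpair_eqE eqxx/=.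
    by move=> /negPf -> /negPf ->.
  move=> [[H1 H2] HD] i j; rewrite mxE; have [ii0|ii0] := eqVneq i i0.
    rewrite mul_givens ii0; have [->//|ja] := eqVneq j a.
    have [->//|jb] := eqVneq j b; have := HD i0 j.
    by rewrite /rest !inE !xpair_eqE eqxx (negPf ja) (negPf jb).
  by have := HD i j; rewrite /rest !inE !xpair_eqE (negPf ii0).
rewrite m'E; last exact: measurable_preimageT.
rewrite (normal_rotation s0 cs1 mBB) -m'E// /m' /= /pushforward/= /mrestr -B3E.
rewrite PX; last exact: mB3.
apply: eq_bigr => i _; apply: eq_bigr => j _; congr (N01 _).
rewrite /B3; have [[-> ->]//|ija] := eqVneq (i, j) (i0, a).
by have [[-> ->]//|ijb] := eqVneq (i, j) (i0, b).
Qed.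

Lemma gaussian_mx_givens m n (X : T -> 'M[R]_(m, n)) a b c s :
  a != b -> s != 0 -> c ^+ 2 + s ^+ 2 = 1 -> gaussian_mx P X ->
  gaussian_mx P (fun w => X w *m givens a b c s).
Proof.
move=> ab s0 cs1 gX.
(* In [Y r] only the first [r] rows have been rotated; the induction rotates one more row at a
   time. *)
pose Y r w := \matrix_(i < m, j < n)
  if (i < r)%N then (X w *m givens a b c s) i j else X w i j.
suff H r : (r <= m)%N -> gaussian_mx P (Y r).
  have -> : (fun w => X w *m givens a b c s) = Y m; last exact: H.
  by apply/funext => w; apply/matrixP => i j; rewrite [RHS]mxE ltn_ord.
elim: r => [_|r IH rm].
  have -> : Y 0%N = X; last by [].
  by apply/funext => w; apply/matrixP => i j; rewrite mxE ltn0.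
have := gaussian_mx_givens_row (Ordinal rm) ab s0 cs1 (IH (ltnW rm)).
congr (gaussian_mx P _); apply/funext => w; apply/matrixP => i j.
rewrite [LHS]mxE [RHS]mxE ltnS leq_eqVlt -val_eqE/=.
have [ir|ir] := eqVneq (i : nat) r; last by rewrite mxE.
by rewrite !mul_givens !mxE ir ltnn.
Qed.

Lemma gaussian_mx_row' m n (X : T -> 'M[R]_(m.+1, n)) :
  gaussian_mx P X -> gaussian_mx P (fun w => row' ord0 (X w)).
Proof.
move=> [mX PX]; split=> [i j|B mB].
  by under eq_fun do rewrite mxE; exact: mX.
pose B' (i : 'I_m.+1) j := if unlift ord0 i is Some i' then B i' j else setT.
have mB' i j : measurable (B' i j).
  by rewrite /B'; case: unliftP => [i' _|_] //; exact: mB.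
transitivity (P [set w | forall i j, B' i j (X w i j)]).
  congr (P _); apply/seteqP; split => w H i j.
    rewrite /B'; case: unliftP => [i' ->|//].
    by have := H i' j; rewrite mxE.
  by have := H (lift ord0 i) j; rewrite /B' liftK mxE.
rewrite PX// big_ord_recl big1 ?mul1e => [|j _]; last first.
  by rewrite /B' unlift_none probability_setT.
by apply: eq_bigr => i _; apply: eq_bigr => j _; rewrite /B' liftK.
Qed.

Lemma gaussian_mx_col' m n (X : T -> 'M[R]_(m, n.+1)) :
  gaussian_mx P X -> gaussian_mx P (fun w => col' ord0 (X w)).
Proof.
move=> gX; have := gaussian_mx_tr (gaussian_mx_row' (gaussian_mx_tr gX)).
congr (gaussian_mx P _); apply/funext => w.
by apply/matrixP => i j; rewrite !mxE.
Qed.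

End one_space.
End gaussian_mx.

(** * Rotating a vector onto a coordinate axis *)

Section orthogonal.
Context {R : realType}.

(** Quantifying over all probability spaces and all numbers of rows makes this a property of [H]
    alone, stable under products. *)
Definition gaussian_preserving n (H : 'M[R]_n) :=
  forall d (T : measurableType d) (P : probability T R) m (X : T -> 'M[R]_(m, n)),
    gaussian_mx P X -> gaussian_mx P (fun w => X w *m H).

Lemma givens_orthogonal n (a b : 'I_n) (c s : R) : a != b -> c ^+ 2 + s ^+ 2 = 1 ->
  givens a b c s *m (givens a b c s)^T = 1%:M.
Proof.
move=> ab cs1; apply: mulmx1C; apply/matrixP => i j.
have ba : b != a by rewrite eq_sym.
have Ga l : givens a b c s a l = if l == a then c else if l == b then - s else 0.
  rewrite mxE eqxx (negPf ab) !mulr1 !mulr0 !addr0.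
  by case: ifPn => // la; case: ifP => // _; rewrite (eq_sym a) (negPf la).
have Gb l : givens a b c s b l = if l == a then s else if l == b then c else 0.
  rewrite mxE eqxx (negPf ba) !mulr1 !mulr0 !add0r.
  by case: ifP => // _; case: ifPn => // lb; rewrite (eq_sym b) (negPf lb).
rewrite mul_givens !(mxE (trmx_key)) Ga Gb [in RHS]mxE.
have [->|ja] := eqVneq j a.
  have [_|ia] := eqVneq i a; first by rewrite -!expr2 cs1.
  by case: ifP => _; rewrite ?mulr0 ?addr0// mulrN mulrC addNr.
have [->|jb] := eqVneq j b.
  have [->|ia] := eqVneq i a; first by rewrite (negPf ab) mulNr mulrC addNr.
  by case: ifP => _; [rewrite mulrNN addrC -!expr2 cs1|rewrite !mulr0 addr0].
rewrite mxE (negPf ja) (negPf jb) !mulr0 !addr0 (eq_sym j i).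
have [ia|_] := eqVneq i a; first by rewrite ia eq_sym (negPf ja).
by have [ib|_//] := eqVneq i b; rewrite ib eq_sym (negPf jb).
Qed.

(* Each Givens rotation annihilates one entry of v. *)
Lemma rotation_to_axis n (v : 'rV[R]_n) (k : 'I_n) : exists H : 'M[R]_n,
  [/\ gaussian_preserving H, H *m H^T = 1%:M,
      exists r, v *m H = r *: delta_mx 0 k &
      forall j, j != k -> v 0 j = 0 -> H *m delta_mx j 0 = delta_mx j 0 :> 'cV_n].
Proof.
(* Induction on the number of nonzero entries of [v] outside position [k]. *)
have [m] := ubnP #|[pred j | (j != k) && (v 0 j != 0)]|.
elim: m v => // m IH v; rewrite ltnS => vm.
have [/existsP[j /andP[jk vj]]|] := boolP [exists j, (j != k) && (v 0 j != 0)].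
  pose r := Num.sqrt (v 0 k ^+ 2 + v 0 j ^+ 2).
  have r2 : r ^+ 2 = v 0 k ^+ 2 + v 0 j ^+ 2.
    by rewrite sqr_sqrtr// addr_ge0 ?sqr_ge0.
  have r0 : r != 0.
    rewrite sqrtr_eq0 -ltNge ltr_wpDl ?sqr_ge0//.
    by rewrite exprn_even_gt0.
  pose G := givens k j (v 0 k / r) (v 0 j / r).
  have cs1 : (v 0 k / r) ^+ 2 + (v 0 j / r) ^+ 2 = 1.
    by rewrite !exprMn -mulrDl -r2 -exprMn divff ?expr1n.
  have kj : k != j by rewrite eq_sym.
  have Gid i : i != k -> i != j -> G *m delta_mx i 0 = delta_mx i 0 :> 'cV_n.
    move=> ik ij; rewrite -colE; apply/colP => l.
    by rewrite !mxE (negPf ik) (negPf ij) eqxx andbT.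
  have vGj : (v *m G) 0 j = 0.
    by rewrite mul_givens (negPf jk) eqxx; field.
  have vGi i : i != k -> i != j -> (v *m G) 0 i = v 0 i.
    by move=> ik ij; rewrite mul_givens (negPf ik) (negPf ij).
  have [|H [gH oH [t vGH] fixH]] := IH (v *m G).
    apply: leq_trans vm; apply: proper_card; apply/properP; split.
      apply/fintype.subsetP => i; rewrite !inE => /andP[ik].
      rewrite ik/=; have [->|ij] := eqVneq i j; first by rewrite vGj eqxx.
      by rewrite vGi.
    by exists j; rewrite !inE jk ?vj ?vGj ?eqxx.
  exists (G *m H); split.
  - move=> d T P p X gX.
    have := gH _ _ _ _ _ (gaussian_mx_givens kj _ cs1 gX).
    rewrite mulf_eq0 invr_eq0 (negPf vj) (negPf r0) => /(_ isT).
    by congr (gaussian_mx P _); apply/funext => w; rewrite mulmxA.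
  - by rewrite trmx_mul mulmxA -(mulmxA G) oH mulmx1 givens_orthogonal.
  - by exists t; rewrite mulmxA.
  (* A position where [v] vanishes is never chosen as [j]: neither [G] nor the later rotations touch
     it. *)
  - move=> i ik vi; have ij : i != j by apply: contra vj => /eqP <-; rewrite vi.
    by rewrite -mulmxA fixH ?Gid// vGi.
rewrite negb_exists => /forallP vk; exists 1%:M; split.
- move=> d T P p X; congr (gaussian_mx P _).
  by apply/funext => w; rewrite mulmx1.
- by rewrite trmx1 mulmx1.
- exists (v 0 k); rewrite mulmx1; apply/rowP => j; rewrite !mxE eqxx/=.
  have [->|jk] := eqVneq j k; first by rewrite mulr1.
  by have := vk j; rewrite jk/= negbK => /eqP ->; rewrite mulr0.
- by move=> j _ _; rewrite mul1mx.
Qed.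

End orthogonal.

(** * Borel sets of matrices *)

Section borel_matrices.
Context {R : realType}.
Local Notation RR := (measurableTypeR R).

Definition rectangles m n : set (set 'M[R]_(m, n)) :=
  [set A | exists2 B : 'I_m -> 'I_n -> set RR, (forall i j, measurable (B i j)) &
    A = [set M : 'M[R]_(m, n) | forall i j, B i j (M i j)]].

(** An alias that equips matrices with the sigma-algebra generated by rectangles, the sets on which
    [gaussian_mx] prescribes the law. *)
Definition borel_mx m n : measurableType _ := g_sigma_algebraType (@rectangles m n).

Lemma measurable_rectangle m n (B : 'I_m -> 'I_n -> set RR) :
  (forall i j, measurable (B i j)) ->
  measurable ([set M | forall i j, B i j (M i j)] : set (borel_mx m n)).
Proof. by move=> mB; apply: sub_sigma_algebra; exists B. Qed.

Lemma measurable_fun_mx d (T : measurableType d) m n (X : T -> 'M[R]_(m, n)) :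
  (forall i j, measurable_fun setT (fun w => X w i j : RR)) ->
  measurable_fun setT (X : T -> borel_mx m n).
Proof.
move=> mX; apply: (@measurability _ _ T (borel_mx m n) setT X (@rectangles m n)) => //.
move=> _ [_ [B mB ->] <-]; rewrite setTI.
exact: (measurable_rect mX mB).
Qed.

(** Rectangles are stable under intersection and include the whole space, so the uniqueness theorem
    for finite measures applies. *)
Lemma borel_mx_measure_unique m n
    (m1 m2 : {measure set (borel_mx m n) -> \bar R}) :
  (forall B, (forall i j, measurable (B i j)) ->
    m1 [set M | forall i j, B i j (M i j)] = m2 [set M | forall i j, B i j (M i j)]) ->
  (m1 setT < +oo)%E ->
  forall A, measurable A -> m1 A = m2 A.
Proof.
move=> m12 m1oo; apply: (@measure_unique _ R (borel_mx m n) (@rectangles m n) (fun=> setT)) => //.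
- move=> _ _ [A mA ->] [B mB ->].
  exists (fun i j => A i j `&` B i j); first by move=> i j; exact: measurableI.
  apply/seteqP; split=> M /=; first by move=> [HA HB] i j.
  by move=> H; split=> i j; have [] := H i j.
- move=> _; exists (fun _ _ => setT) => //.
  by apply/seteqP; split.
- by rewrite bigcup_const.
- by move=> _ [B mB ->]; exact: m12.
Qed.

(** This allows a Gaussian matrix to be replaced by a rotated copy in the probability of any
    measurable event. *)
Lemma gaussian_mx_law d d' (T : measurableType d) (T' : measurableType d')
    (P : probability T R) (P' : probability T' R) m n
    (X : T -> 'M[R]_(m, n)) (X' : T' -> 'M[R]_(m, n)) (E : set (borel_mx m n)) :
  gaussian_mx P X -> gaussian_mx P' X' -> measurable E ->
  P (X @^-1` E) = P' (X' @^-1` E).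
Proof.
move=> [mX PX] [mX' PX'].
apply: (@borel_mx_measure_unique _ _ (image_measure P (measurable_fun_mx mX))
  (image_measure P' (measurable_fun_mx mX'))).
- by move=> B mB; rewrite /= /pushforward/= [LHS]PX// [RHS]PX'.
- by rewrite /= /pushforward preimage_setT probability_setT ltry.
Qed.

Let near_common (q u x y e : R) : u < e / 2 ->
  q - u < x < q + u -> q - u < y < q + u -> `|x - y| < e.
Proof.
move=> ue /andP[x1 x2] /andP[y1 y2]; rewrite ltr_norml; apply/andP; split; lra.
Qed.

(** An open set is the union of the cubes with rational centre and radius [k.+1%:R^-1] that it
    contains, and there are countably many of them. *)
Lemma open_measurable_mx m n (U : set 'M[R]_(m, n)) :
  open U -> measurable (U : set (borel_mx m n)).
Proof.
move=> oU.
pose rect (qk : 'M[rat]_(m, n) * nat) : set (borel_mx m n) :=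
  [set M | forall i j, `](ratr (qk.1 i j) - qk.2.+1%:R^-1),
                       (ratr (qk.1 i j) + qk.2.+1%:R^-1)[%classic (M i j)].
have -> : U = \bigcup_qk (if `[< rect qk `<=` U >] then rect qk else set0).
  apply/seteqP; split=> [M UM|M [qk _]]; last first.
    by case: asboolP => // + rM; exact.
  have /nbhs_ballP[e e0 eU] : nbhs M U by exact: open_nbhs_nbhs.
  (* With a radius below [e / 2], any two points of the cube differ by less than [e] in each entry,
     so a cube containing [M] lies in the ball. *)
  have [k ke] : exists k, k.+1%:R^-1 < e / 2.
    have [k] : exists k, 0 + k.+1%:R^-1 < e / 2 by apply: ltr_add_invr; exact: divr_gt0.
    by rewrite add0r; exists k.
  have k0 : 0 < k.+1%:R^-1 :> R by rewrite invr_gt0.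
  have qP i j : {q : rat | ratr q \in `](M i j - k.+1%:R^-1), (M i j + k.+1%:R^-1)[}.
    by apply/cid/rat_in_itvoo; rewrite ltrBlDr -addrA ltrDl addr_gt0.
  have rM : rect (\matrix_(i, j) sval (qP i j), k) M.
    move=> i j /=; rewrite mxE; case: (qP i j) => q /=; rewrite !in_itv/=.
    by move=> /andP[q1 q2]; rewrite ltrBlDr q2/= -ltrBlDr.
  exists (\matrix_(i, j) sval (qP i j), k) => //.
  rewrite ifT//; apply/asboolP => N rN; apply: eU; split => // i j.
  have := rM i j; have := rN i j; rewrite /= !in_itv/= => rN' rM'.
  by rewrite /ball/=; exact: near_common ke rM' rN'.
apply: countable_bigcupT_measurable; first exact: countableP.
move=> qk; case: asboolP => // _.
apply: (@measurable_rectangle _ _ (fun i j =>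
  `](ratr (qk.1 i j) - qk.2.+1%:R^-1), (ratr (qk.1 i j) + qk.2.+1%:R^-1)[%classic)).
by move=> i j; exact: measurable_itv.
Qed.

Lemma closed_measurable_mx m n (K : set 'M[R]_(m, n)) :
  closed K -> measurable (K : set (borel_mx m n)).
Proof.
move=> cK; rewrite -[K]setCK; apply: measurableC.
by apply: open_measurable_mx; rewrite openC.
Qed.

Lemma continuous_mx (T : topologicalType) m n (f : T -> 'M[R]_(m, n)) :
  (forall i j, continuous (fun x => f x i j)) -> continuous f.
Proof.
move=> cf x A [B nB BA].
have H : \forall y \near x, forall ij : 'I_m * 'I_n, B ij.1 ij.2 (f y ij.1 ij.2).
  apply: filter_forall => -[i j] /=; exact: cf (nB i j).
by apply: filterS H => y H; apply: BA => i j; exact: (H (i, j)).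
Qed.

Lemma closed_slice m n (K : set 'cV[R]_m) (r : nat) : closed K ->
  closed [set M : 'M[R]_(m, n) |
    exists y : 'rV[R]_n, (forall j, `[- r%:R, r%:R]%classic (y ord0 j)) /\ K (M *m y^T)].
Proof.
move=> cK; rewrite -openC openE => M /= HM.
have cB := @rV_compact R n (fun=> `[- r%:R, r%:R]%classic)
  (fun=> @segment_compact R (- r%:R) r%:R).
(* If no [y] in the compact cube sends [M] into [K], each such [y] has a neighbourhood that works
   for all matrices near [M]; compactness gives one neighbourhood of [M] for all [y]. *)
have := (compact_near_coveringP _).1 cB 'M[R]_(m, n) (nbhs M)
  (fun M y => ~ K (M *m y^T)) _.
move=> /(_ _) H; apply: filterS (H _) => [N HN [y [yr Ky]]|y yr].
  exact: HN yr Ky.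
have cf : continuous (fun z : 'rV[R]_n * 'M[R]_(m, n) => z.2 *m z.1^T).
  apply: continuous_mx => i j.
  have -> : (fun z : 'rV[R]_n * 'M[R]_(m, n) => (z.2 *m z.1^T) i j) =
      (fun z => \sum_l z.2 i l * z.1 ord0 l).
    apply/funext => z; rewrite mxE; apply: eq_bigr => l _.
    by rewrite mxE (ord1 j).
  apply: continuous_big => [|l _ z]; first exact: add_continuous.
  apply: cvgM.
    apply: (@continuous_comp _ _ _ snd (fun M : 'M[R]_(m, n) => M i l)).
      exact: cvg_snd.
    exact: coord_continuous.
  apply: (@continuous_comp _ _ _ fst (fun y : 'rV[R]_n => y ord0 l)).
    exact: cvg_fst.
  exact: coord_continuous.
have : \forall z \near (y, M), (~` K) (z.2 *m z.1^T).
  apply: (cf (y, M)); apply: open_nbhs_nbhs; split; first by rewrite openC.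
  by move=> KMy; apply: HM; exists y.
by [].
Qed.

(** The set need not be closed, since [y] is unbounded; restricting [y] to the cubes of integer size
    writes it as a countable union of the closed sets of [closed_slice]. *)
Lemma measurable_hits m n (K : set 'cV[R]_m) : closed K ->
  measurable ([set M | exists y : 'cV[R]_n, K (M *m y)] : set (borel_mx m n)).
Proof.
move=> cK; rewrite (_ : mkset _ = \bigcup_r [set M : 'M[R]_(m, n) |
    exists y : 'rV[R]_n, (forall j, `[- r%:R, r%:R]%classic (y ord0 j)) /\ K (M *m y^T)]).
  by apply: bigcupT_measurable => r; apply: closed_measurable_mx; exact: closed_slice.
apply/seteqP; split=> [M [y Ky]|M [r _ [y [_ Ky]]]]; last by exists y^T.
exists (Num.bound (\sum_j `|y j 0|)) => //; exists y^T; rewrite trmxK; split=> // j.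
rewrite /= in_itv/= -ler_norml mxE.
apply: le_trans (ltW (archi_boundP _)); last exact: sumr_ge0.
by rewrite (bigD1 j)//= lerDl sumr_ge0.
Qed.

End borel_matrices.

(** * Standard normal vectors *)

Section gauss_tuple.
Context {R : realType}.
Local Notation mu := (@lebesgue_measure R).
Local Notation RR := (measurableTypeR R).
Local Notation N01 := (@normal_prob R 0 1).

HB.instance Definition _ n := isMeasurableFun.Build _ _ _ _
  (@tuple_cons R n) (@measurable_tuple_cons R n).

(** The recursion is that of [lebesgue_tuple], so that integrals against both measures unfold
    coordinate by coordinate in the same way. *)
Fixpoint gauss_tuple n : probability (n.-tuple R) R :=
  if n is n'.+1 then distribution (N01 \x gauss_tuple n')%E (@tuple_cons R n')
  else dirac [tuple].

Lemma integral_gauss_tuple_cons n (F : n.+1.-tuple R -> \bar R) :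
  measurable_fun setT F -> (forall t, 0 <= F t)%E ->
  (\int[gauss_tuple n.+1]_t F t =
   \int[N01]_x \int[gauss_tuple n]_t F (tuple_cons (x, t)))%E.
Proof.
move=> mF F0.
have mG := measurableT_comp mF (@measurable_tuple_cons R n).
rewrite [LHS](ge0_integral_image _ (@measurable_tuple_cons R n) mF F0).
exact: (@fubini_tonelli1 _ _ _ _ _ N01 (gauss_tuple n) _ mG (fun z => F0 _)).
Qed.

Lemma integral_lebesgue_tuple_cons n (F : n.+1.-tuple R -> \bar R) :
  measurable_fun setT F -> (forall t, 0 <= F t)%E ->
  (\int[lebesgue_tuple n.+1]_t F t =
   \int[mu]_x \int[lebesgue_tuple n]_t F (tuple_cons (x, t)))%E.
Proof.
move=> mF F0.
have mG := measurableT_comp mF (@measurable_tuple_cons R n).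
rewrite [LHS](ge0_integral_image _ (@measurable_tuple_cons R n) mF F0).
exact: (@fubini_tonelli1 _ _ _ _ _ mu (lebesgue_tuple n) _ mG (fun z => F0 _)).
Qed.

Lemma tnth_tuple_cons0 n (z : RR * n.-tuple R) : tnth (tuple_cons z) ord0 = z.1.
Proof. by []. Qed.

Lemma tnth_tuple_consS n (z : RR * n.-tuple R) i :
  tnth (tuple_cons z) (lift ord0 i) = tnth z.2 i.
Proof. by rewrite tnthS. Qed.

Definition sqnorm n (t : n.-tuple R) : R := \sum_i tnth t i ^+ 2.

Lemma sqnorm_ge0 n (t : n.-tuple R) : 0 <= sqnorm t.
Proof. by apply: sumr_ge0 => i _; exact: sqr_ge0. Qed.

Lemma sqnorm_cons n (z : RR * n.-tuple R) :
  sqnorm (tuple_cons z) = z.1 ^+ 2 + sqnorm z.2.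
Proof.
rewrite /sqnorm big_ord_recl; congr (_ + _).
by apply: eq_bigr => i _; rewrite tnth_tuple_consS.
Qed.

Lemma measurable_sqnorm n : measurable_fun setT (@sqnorm n).
Proof.
apply: measurable_sum => i; apply: measurable_funX; exact: measurable_tnth.
Qed.

Definition scale_tuple n (a : R) (t : n.-tuple R) : n.-tuple R :=
  [tuple of [seq a * x | x <- t]].

Lemma measurable_scale_tuple n a : measurable_fun setT (@scale_tuple n a).
Proof.
apply/measurable_fun_tnthP => i.
rewrite (_ : _ \o _ = fun t => a * tnth t i); last first.
  by apply/funext => t /=; rewrite tnth_map.
by apply: measurable_funM => //; exact: measurable_tnth.
Qed.

Lemma scale_tuple_cons n a x (t : n.-tuple R) :
  scale_tuple a (tuple_cons (x, t)) = tuple_cons (a * x, scale_tuple a t).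
Proof. exact: val_inj. Qed.

Lemma sqnorm_scale n a (t : n.-tuple R) : sqnorm (scale_tuple a t) = a ^+ 2 * sqnorm t.
Proof.
rewrite /sqnorm mulr_sumr; apply: eq_bigr => i _.
by rewrite tnth_map exprMn.
Qed.

(** The exponential factor turns the standard normal density into a multiple of the normal density
    of standard deviation [a]; substituting [a * x] makes it standard again, at the price of the
    Jacobian [a]. *)
Lemma gauss_scale (s a : R) (F : RR -> \bar R) : 0 < a -> (1 + s) * a ^+ 2 = 1 ->
  measurable_fun setT F -> (forall x, 0 <= F x)%E ->
  (\int[N01]_x (F x * (expR (- (s * x ^+ 2) / 2))%:E) =
   a%:E * \int[N01]_x F (a * x)%R)%E.
Proof.
move=> a0 sa mF F0.
have mexp : measurable_fun setT (fun x : RR => expR (- (s * x ^+ 2) / 2) : RR).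
  apply: measurableT_comp => //; apply: measurable_funM => //.
  apply: measurableT_comp => //; apply: measurable_funM => //.
have mFe : measurable_fun setT (fun x => (F x * (expR (- (s * x ^+ 2) / 2))%:E)%E).
  by apply: emeasurable_funM => //; exact/measurable_EFinP.
have maff : measurable_fun setT (fun x : RR => a * x : RR) by exact: measurable_funM.
have mphi := @measurable_phi R.
rewrite ge0_integral_normal; last 2 first.
- exact: mFe.
- by move=> x; rewrite mule_ge0// lee_fin expR_ge0.
rewrite ge0_integral_normal; last 2 first.
- exact: measurableT_comp.
- by [].
rewrite (@integral_lebesgue_affine R a 0); last 3 first.
- by rewrite gt_eqF.
- by apply: emeasurable_funM => //; exact/measurable_EFinP.
- by move=> x; rewrite !mule_ge0// lee_fin ?expR_ge0 ?normal_pdf_ge0.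
rewrite (gtr0_norm a0); apply: congr1; apply: eq_integral => x _.
rewrite addr0 -muleA -EFinM; congr (_ * _%:E)%E.
rewrite !phiE mulrCA -expRD; congr (_ * expR _).
transitivity (- ((1 + s) * a ^+ 2) * x ^+ 2 / 2); first by field.
by rewrite sa mulN1r.
Qed.

Lemma gauss_tuple_scale n (s a : R) (F : n.-tuple R -> \bar R) :
  0 < a -> (1 + s) * a ^+ 2 = 1 ->
  measurable_fun setT F -> (forall x, 0 <= F x)%E ->
  (\int[gauss_tuple n]_t (F t * (expR (- (s * sqnorm t) / 2))%:E) =
   (a ^+ n)%:E * \int[gauss_tuple n]_t F (scale_tuple a t))%E.
Proof.
move=> a0 sa; elim: n F => [|n IH] F mF F0.
  rewrite mul1e; apply: eq_integral => t _.
  by rewrite /sqnorm big_ord0 mulr0 oppr0 mul0r expR0 mule1 (tuple0 t) [scale_tuple _ _]tuple0.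
have mexp k : measurable_fun setT (fun t : k.-tuple R => (expR (- (s * sqnorm t) / 2))%:E).
  apply/measurable_EFinP; apply: measurableT_comp => //; apply: measurable_funM => //.
  apply: measurableT_comp => //; apply: measurable_funM => //.
  exact: measurable_sqnorm.
have mcons x : measurable_fun setT (fun t : n.-tuple R => tuple_cons (x : RR, t)).
  exact: measurableT_comp (@measurable_tuple_cons R n) _.
have mscale := @measurable_scale_tuple.
rewrite integral_gauss_tuple_cons; last 2 first.
- by apply: emeasurable_funM => //; exact: mexp.
- by move=> t; rewrite mule_ge0// lee_fin expR_ge0.
rewrite integral_gauss_tuple_cons; last 2 first.
- exact: measurableT_comp (mscale _ _).
- by [].
pose G (x : RR) := (\int[gauss_tuple n]_t F (tuple_cons (x, scale_tuple a t)))%E.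
have mG : measurable_fun setT G.
  apply: (measurable_fun_fubini_tonelli_F
    (fun z : RR * n.-tuple R => F (tuple_cons (z.1, scale_tuple a z.2)))) => //.
  apply: measurableT_comp => //.
  apply: (measurableT_comp (@measurable_tuple_cons R n)).
  apply: measurable_fun_pair => //; exact: measurableT_comp (mscale _ _) _.
have G0 x : (0 <= G x)%E by apply: integral_ge0.
transitivity (\int[N01]_x ((a ^+ n)%:E * (G x * (expR (- (s * x ^+ 2) / 2))%:E)))%E.
  apply: eq_integral => x _.
  have -> : ((a ^+ n)%:E * (G x * (expR (- (s * x ^+ 2) / 2))%:E) =
    (expR (- (s * x ^+ 2) / 2))%:E * \int[gauss_tuple n]_t
      (F (tuple_cons (x, t)) * (expR (- (s * sqnorm t) / 2))%:E))%E.
    rewrite (IH (fun t => F (tuple_cons (x, t))))//; first by rewrite muleA muleC.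
    exact: measurableT_comp (mcons x).
  rewrite -ge0_integralZl; last 4 first.
  - exact: measurableT.
  - by apply: emeasurable_funM; [exact: measurableT_comp (mcons x)|exact: mexp].
  - by move=> t _; rewrite mule_ge0// lee_fin expR_ge0.
  - by rewrite lee_fin expR_ge0.
  apply: eq_integral => t _; rewrite sqnorm_cons/= muleCA -EFinM -expRD.
  by congr (_ * (expR _)%:E)%E; ring.
rewrite ge0_integralZl; last 4 first.
- exact: measurableT.
- apply: emeasurable_funM => //; apply/measurable_EFinP.
  apply: measurableT_comp => //; apply: measurable_funM => //.
  apply: measurableT_comp => //; apply: measurable_funM => //.
- by move=> x _; rewrite mule_ge0// lee_fin expR_ge0.
- by rewrite lee_fin exprn_ge0// ltW.
rewrite (gauss_scale a0 sa mG G0) muleA -EFinM -exprSr; congr (_ * _)%E.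
by apply: eq_integral => x _; apply: eq_integral => t _; rewrite scale_tuple_cons.
Qed.

End gauss_tuple.

(** * Products of one-dimensional integrals and scaled normal variables *)

Section tuple_integrals.
Context {R : realType}.
Local Notation mu := (@lebesgue_measure R).
Local Notation RR := (measurableTypeR R).
Local Notation N01 := (@normal_prob R 0 1).
Local Notation phi := (@normal_pdf R 0 1).

Lemma measurable_tuple_box n (B : 'I_n -> set RR) : (forall i, measurable (B i)) ->
  measurable [set t : n.-tuple R | forall i, B i (tnth t i)].
Proof.
move=> mB; rewrite (_ : mkset _ = \bigcap_(i in [set: 'I_n]) ((@tnth n R)^~ i @^-1` B i)).
  apply: fin_bigcap_measurable => // i _.
  exact: (measurable_preimageT (measurable_tnth i) (mB i)).
by apply/seteqP; split => t /= H; [move=> i _; exact: H|move=> i; exact: (H i)].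
Qed.

Lemma gauss_tuple_box n (B : 'I_n -> set RR) : (forall i, measurable (B i)) ->
  gauss_tuple n [set t | forall i, B i (tnth t i)] = (\prod_i N01 (B i))%E.
Proof.
elim: n B => [|n IH] B mB.
  by rewrite big_ord0 /= /dirac indicE mem_set//= => -[].
pose B' i := B (lift ord0 i).
have mB' i : measurable (B' i) by exact: mB.
transitivity ((N01 \x gauss_tuple n)%E
    (B ord0 `*` [set t | forall i, B' i (tnth t i)])).
  rewrite /= /distribution /pushforward; congr (_ _).
  apply/seteqP; split => [[x t] H|[x t] [/= Hx Ht]].
    split; first by have := H ord0; rewrite tnth_tuple_cons0.
    by move=> i; have := H (lift ord0 i); rewrite tnth_tuple_consS.
  move=> i; case: (unliftP ord0 i) => [j ->|->].
    by rewrite tnth_tuple_consS; exact: Ht.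
  by rewrite tnth_tuple_cons0.
rewrite product_measure1E; last 2 first.
- exact: mB.
- exact: measurable_tuple_box.
by rewrite big_ord_recl; congr (_ * _)%E; exact: (IH _ mB').
Qed.

Lemma prod_integral_lebesgue_tuple m (f : 'I_m -> RR -> R) :
  (forall j, measurable_fun setT (f j)) -> (forall j x, 0 <= f j x) ->
  (\prod_j \int[mu]_x (f j x)%:E =
   \int[lebesgue_tuple m]_t (\prod_j f j (tnth t j))%:E)%E.
Proof.
elim: m f => [|m IH] f mf f0.
  rewrite big_ord0.
  under eq_integral do rewrite big_ord0.
  by rewrite integral_cst//= diracT mul1e.
have mprod k (g : 'I_k -> RR -> R) : (forall j, measurable_fun setT (g j)) ->
    measurable_fun setT (fun t : k.-tuple R => (\prod_j g j (tnth t j))%:E).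
  move=> mg; apply/measurable_EFinP; apply: measurable_prod => j _.
  exact: measurableT_comp (mg j) (measurable_tnth j).
rewrite integral_lebesgue_tuple_cons; last 2 first.
- exact: mprod.
- by move=> t; rewrite lee_fin prodr_ge0.
rewrite big_ord_recl IH//.
set I := (\int[lebesgue_tuple m]_t _)%E.
rewrite -ge0_integralZr; last 4 first.
- exact: measurableT.
- exact/measurable_EFinP.
- by move=> x _; rewrite lee_fin.
- by apply: integral_ge0 => t _; rewrite lee_fin prodr_ge0.
apply: eq_integral => x _; rewrite /I.
rewrite -ge0_integralZl; last 4 first.
- exact: measurableT.
- exact: (mprod m (fun j => f (lift ord0 j)) (fun j => mf _)).
- by move=> t _; rewrite lee_fin prodr_ge0.
- by rewrite lee_fin.
apply: eq_integral => t _; rewrite -EFinM; congr (_%:E).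
rewrite [RHS]big_ord_recl tnth_tuple_cons0; congr (_ * _).
by apply: eq_bigr => j _; rewrite tnth_tuple_consS.
Qed.

(* The density of zeta / rho times a standard normal variable when rho != 0;
   it vanishes for rho = 0. *)
Definition scaled_normal_pdf (zeta rho t : R) : R :=
  `|rho / zeta| * phi (rho / zeta * t).

Lemma scaled_normal_pdf_ge0 zeta rho t : 0 <= scaled_normal_pdf zeta rho t.
Proof. by rewrite mulr_ge0// normal_pdf_ge0. Qed.

Lemma measurable_scaled_normal_pdf zeta rho :
  measurable_fun setT (scaled_normal_pdf zeta rho : RR -> RR).
Proof.
apply: measurable_funM => //; apply: measurableT_comp; first exact: measurable_phi.
exact: measurable_funM.
Qed.

Lemma normal_prob_scale (zeta rho : R) (Q : set RR) :
  zeta != 0 -> rho != 0 -> measurable Q ->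
  (N01 [set x | Q (zeta / rho * x)%R] =
   \int[mu]_t (\1_Q t * scaled_normal_pdf zeta rho t)%:E)%E.
Proof.
move=> z0 r0 mQ.
have mQ' : measurable ([set x | Q (zeta / rho * x)] : set RR).
  apply: (@measurable_preimageT _ _ RR RR (fun x => zeta / rho * x)) => //.
  exact: measurable_funM.
have mf : measurable_fun setT (fun x : RR => (\1_[set x | Q (zeta / rho * x)] x * phi x)%:E).
  apply/measurable_EFinP; apply: measurable_funM; first exact: measurable_indic.
  exact: measurable_phi.
transitivity (\int[mu]_x (\1_[set x | Q (zeta / rho * x)%R] x * phi x)%:E)%E.
  rewrite /normal_prob integral_mkcond; apply: eq_integral => x _.
  rewrite /= patchE indicE; case: ifPn => xA; first by rewrite mul1r.
  by rewrite mul0r.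
rewrite (@integral_lebesgue_affine R (rho / zeta) 0); last 3 first.
- by rewrite mulf_neq0// invr_eq0.
- exact: mf.
- by move=> x; rewrite lee_fin mulr_ge0 ?normal_pdf_ge0.
rewrite -ge0_integralZl; last 4 first.
- exact: measurableT.
- exact: (measurableT_comp mf (measurable_affine (rho / zeta) 0)).
- by move=> x _; rewrite lee_fin mulr_ge0 ?normal_pdf_ge0.
- by rewrite lee_fin.
apply: eq_integral => t _; rewrite -EFinM mulrCA addr0; congr (_ * _)%:E.
rewrite !indicE; congr ((_ : bool)%:R); apply/idP/idP; rewrite !inE/=;
  by rewrite mulrA mulrA divfK// mulfV// mul1r.
Qed.

End tuple_integrals.

Lemma mule_eq1_fin_num (R : realType) (a x : \bar R) :
  (a * x = 1)%E -> x \is a fin_num.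
Proof.
move=> ax; rewrite fin_numE; apply/andP; split; apply/eqP => xoo; move: ax.
  rewrite xoo; have [a0|a0|->] := ltgtP a 0%E.
  - by rewrite lt0_muleNy.
  - by rewrite gt0_muleNy.
  - by rewrite mul0e => /eqP; rewrite eq_sym onee_eq0.
rewrite xoo; have [a0|a0|->] := ltgtP a 0%E.
- by rewrite lt0_muley.
- by rewrite gt0_muley.
- by rewrite mul0e => /eqP; rewrite eq_sym onee_eq0.
Qed.

(** Used to identify normalizing constants without computing them: a product equal to 1 has finite
    nonzero factors, so [x] can be cancelled. *)
Lemma mule_eq1_unique (R : realType) (a b x : \bar R) :
  (a * x = 1 -> b * x = 1 -> a = b)%E.
Proof.
move=> ax bx.
have := mule_eq1_fin_num ax; have := @mule_eq1_fin_num R x a; rewrite muleC => /(_ ax).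
have := @mule_eq1_fin_num R x b; rewrite muleC => /(_ bx).
move: ax bx; case: a => // a; case: b => // b; case: x => // x [ax] [bx] _ _ _.
have x0 : x != 0 by apply: contra_eq_neq ax => ->; rewrite mulr0 eq_sym oner_eq0.
by congr EFin; apply: (mulIf x0); rewrite ax bx.
Qed.

(** * The law of a normal vector divided by an independent norm *)

Section kernel.
Context {R : realType}.
Local Notation mu := (@lebesgue_measure R).
Local Notation RR := (measurableTypeR R).
Local Notation N01 := (@normal_prob R 0 1).
Variables (zeta : R) (m n : nat).
Hypothesis z0 : zeta != 0.

(* Probability that the quotient of [zeta] times a standard normal vector in
   R^m by the norm of an independent standard normal vector in R^n is in
   the box Q. *)
Definition ratio_prob (Q : nat -> set RR) : \bar R :=
  (\int[gauss_tuple n]_v \prod_(j < m) \int[mu]_x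
     (\1_(Q j) x * scaled_normal_pdf zeta (Num.sqrt (sqnorm v)) x)%:E)%E.

(** The density, up to a constant factor, of the t-distribution with parameters [n] and
    [zeta ^+ 2 / n] times the identity. *)
Definition t_kernel (t : m.-tuple R) : R :=
  (1 + sqnorm t / zeta ^+ 2) `^ (- ((m%:R + n%:R) / 2)).

(** What remains of the integral over [v] once the dependence on [t] is scaled out. As an extended
    real it requires no prior proof that the moment is finite. *)
Definition ratio_const : \bar R :=
  (((normal_peak 1 / `|zeta|) ^+ m)%:E *
   \int[gauss_tuple n]_v (Num.sqrt (sqnorm v) ^+ m)%:E)%E.

Lemma t_kernel_ge0 t : 0 <= t_kernel t.
Proof. exact: powR_ge0. Qed.

Lemma measurable_t_kernel : measurable_fun setT t_kernel.
Proof.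
apply: (measurableT_comp (@measurable_powR R _)).
apply: measurable_funD => //; apply: measurable_funM => //.
exact: measurable_sqnorm.
Qed.

Let measurable_sqrt_sqnorm k :
  measurable_fun setT (fun v : k.-tuple R => Num.sqrt (sqnorm v) : RR).
Proof.
apply: (@measurableT_comp _ _ _ _ RR RR (@Num.sqrt R)); last exact: measurable_sqnorm.
by apply: continuous_measurable_fun; exact: sqrt_continuous.
Qed.

Let prod_scaled_normal_pdf (v : n.-tuple R) (t : m.-tuple R) :
  \prod_j scaled_normal_pdf zeta (Num.sqrt (sqnorm v)) (tnth t j) =
  (normal_peak 1 / `|zeta|) ^+ m * (Num.sqrt (sqnorm v) ^+ m *
    expR (- ((sqnorm t / zeta ^+ 2) * sqnorm v) / 2)).
Proof.
rewrite (eq_bigr (fun j : 'I_m => (normal_peak 1 / `|zeta| * Num.sqrt (sqnorm v)) *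
    expR (- (tnth t j ^+ 2 / zeta ^+ 2 * sqnorm v) / 2))).
  rewrite big_split/= prodr_const card_ord exprMn -[LHS]mulrA; congr (_ * (_ * _)).
  rewrite -expR_sum; congr expR.
  by rewrite /sqnorm -mulr_suml sumrN -!mulr_suml.
move=> j _; rewrite /scaled_normal_pdf phiE normrM normfV (ger0_norm (sqrtr_ge0 _)).
rewrite mulrA; congr (_ * expR _); first by rewrite mulrC mulrA mulrAC.
rewrite exprMn exprMn exprVn sqr_sqrtr ?sqnorm_ge0//.
by congr (- _ / _); ring.
Qed.

(** Rescaling [v] by [a] absorbs the exponential. The Jacobian contributes [a ^+ n] and the power of
    the norm contributes [a ^+ m], whence the exponent of [t_kernel]. *)
Let scaling (t : m.-tuple R) :
  (\int[gauss_tuple n]_v (Num.sqrt (sqnorm v) ^+ m *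
    expR (- ((sqnorm t / zeta ^+ 2) * sqnorm v) / 2))%:E =
  (t_kernel t)%:E * \int[gauss_tuple n]_v (Num.sqrt (sqnorm v) ^+ m)%:E)%E.
Proof.
set s := sqnorm t / zeta ^+ 2.
have s0 : 0 <= s by rewrite divr_ge0 ?sqr_ge0 ?sqnorm_ge0.
have s1 : 0 < 1 + s by rewrite ltr_pwDl.
pose a := (1 + s) `^ (- (1 / 2)).
have a0 : 0 < a by rewrite powR_gt0.
have aX k : a ^+ k = (1 + s) `^ (- (k%:R / 2)).
  by rewrite -powR_mulrn ?powR_ge0// -powRrM; congr (_ `^ _); field.
have sa : (1 + s) * a ^+ 2 = 1.
  by rewrite aX divff// powR_inv1 ?ltW// mulfV// gt_eqF.
have msq : measurable_fun setT (fun v : n.-tuple R => (Num.sqrt (sqnorm v) ^+ m)%:E).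
  by apply/measurable_EFinP; apply: measurable_funX; exact: measurable_sqrt_sqnorm.
under eq_integral do rewrite EFinM.
rewrite (gauss_tuple_scale a0 sa msq); last by move=> v; rewrite lee_fin exprn_ge0// sqrtr_ge0.
under eq_integral => v _.
  rewrite sqnorm_scale sqrtrM ?sqr_ge0// sqrtr_sqr gtr0_norm// exprMn EFinM.
  over.
rewrite ge0_integralZl; last 4 first.
- exact: measurableT.
- exact: msq.
- by move=> v _; rewrite lee_fin exprn_ge0// sqrtr_ge0.
- by rewrite lee_fin exprn_ge0// ltW.
by rewrite muleA -EFinM -exprD aX addnC natrD.
Qed.

Let joint (Q : nat -> set RR) (z : n.-tuple R * m.-tuple R) : R :=
  (\prod_(j < m) \1_(Q j) (tnth z.2 j)) * ((normal_peak 1 / `|zeta|) ^+ m *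
  (Num.sqrt (sqnorm z.1) ^+ m * expR (- ((sqnorm z.2 / zeta ^+ 2) * sqnorm z.1) / 2))).

Let joint_ge0 Q z : 0 <= joint Q z.
Proof.
by rewrite !mulr_ge0 ?prodr_ge0// ?exprn_ge0 ?sqrtr_ge0 ?expR_ge0 ?mulr_ge0
  ?invr_ge0 ?normal_peak_ge0.
Qed.

Let measurable_joint Q : (forall j, measurable (Q j)) ->
  measurable_fun setT (EFin \o joint Q).
Proof.
move=> mQ; apply/measurable_EFinP; apply: measurable_funM.
  apply: measurable_prod => j _.
  have mI : measurable_fun setT (\1_(Q j) : RR -> RR) by exact: measurable_indic.
  exact: measurableT_comp mI (measurableT_comp (measurable_tnth j) measurable_snd).
apply: measurable_funM => //; apply: measurable_funM.
  apply: measurable_funX.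
  exact: measurableT_comp (@measurable_sqrt_sqnorm n) measurable_fst.
apply: measurableT_comp => //; apply: measurable_funM => //.
apply: measurableT_comp => //; apply: measurable_funM.
  apply: measurable_funM => //.
  exact: measurableT_comp (@measurable_sqnorm R m) measurable_snd.
exact: measurableT_comp (@measurable_sqnorm R n) measurable_fst.
Qed.

Let ratio_integrandE (Q : nat -> set RR) (v : n.-tuple R) : (forall j, measurable (Q j)) ->
  (\prod_(j < m) \int[mu]_x
     (\1_(Q j) x * scaled_normal_pdf zeta (Num.sqrt (sqnorm v)) x)%:E =
   \int[lebesgue_tuple m]_t (joint Q (v, t))%:E)%E.
Proof.
move=> mQ; rewrite (@prod_integral_lebesgue_tuple _ m (fun j x =>
    \1_(Q j) x * scaled_normal_pdf zeta (Num.sqrt (sqnorm v)) x)); last 2 first.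
- move=> j; apply: measurable_funM; first exact: measurable_indic.
  exact: measurable_scaled_normal_pdf.
- by move=> j x; rewrite mulr_ge0// scaled_normal_pdf_ge0.
apply: eq_integral => t _; congr (_%:E).
by rewrite big_split/= prod_scaled_normal_pdf.
Qed.

Lemma measurable_ratio_integrand (Q : nat -> set RR) : (forall j, measurable (Q j)) ->
  measurable_fun setT (fun v : n.-tuple R => \prod_(j < m) \int[mu]_x
     (\1_(Q j) x * scaled_normal_pdf zeta (Num.sqrt (sqnorm v)) x)%:E)%E.
Proof.
move=> mQ; under eq_fun do rewrite ratio_integrandE//.
exact: (@measurable_fun_fubini_tonelli_F _ _ _ _ _ (lebesgue_tuple m) _
  (measurable_joint mQ) (fun z => joint_ge0 Q z)).
Qed.

(** Tonelli moves the integral over [v] inside, where [scaling] evaluates it for each [t]. *)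
Lemma ratio_prob_kernel Q : (forall j, measurable (Q j)) ->
  (ratio_prob Q = ratio_const * \int[lebesgue_tuple m]_(t in
    [set t : m.-tuple R | forall j, Q (j : 'I_m) (tnth t j)]) (t_kernel t)%:E)%E.
Proof.
move=> mQ; rewrite /ratio_prob.
set B := [set t : m.-tuple R | _].
have mB : measurable B by exact: (@measurable_tuple_box R m (fun j => Q j)).
have prodB (t : m.-tuple R) : \prod_(j < m) \1_(Q j) (tnth t j) = \1_B t :> R.
  rewrite indicE; have [tB|tB] := boolP (t \in B).
    rewrite big1// => j _; rewrite indicE mem_set//.
    by move: tB; rewrite inE; exact.
  have [j nQ] : exists j, ~ Q (j : 'I_m) (tnth t j).
    by apply/existsNP => H; move/negP: tB; apply; rewrite inE.
  by rewrite (bigD1 j)//= indicE memNset// mul0r.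
pose c := (normal_peak 1 / `|zeta|) ^+ m.
have c0 : 0 <= c by rewrite exprn_ge0// divr_ge0// normal_peak_ge0.
transitivity (\int[gauss_tuple n]_v \int[lebesgue_tuple m]_t (joint Q (v, t))%:E)%E.
  by apply: eq_integral => v _; exact: ratio_integrandE.
rewrite (@fubini_tonelli _ _ _ _ _ (gauss_tuple n) (lebesgue_tuple m) _
  (measurable_joint mQ)); last by move=> z; rewrite lee_fin.
rewrite /ratio_const -/c -muleA.
set Psi := (\int[gauss_tuple n]_v _)%E.
have Psi0 : (0 <= Psi)%E.
  by apply: integral_ge0 => v _; rewrite lee_fin exprn_ge0// sqrtr_ge0.
transitivity (\int[lebesgue_tuple m]_t ((\1_B t * t_kernel t)%:E * (c%:E * Psi)))%E.
  apply: eq_integral => t _; rewrite /joint/= prodB -/c.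
  under eq_integral do rewrite mulrA EFinM.
  rewrite ge0_integralZl; last 4 first.
  - exact: measurableT.
  - apply/measurable_EFinP; apply: measurable_funM.
      by apply: measurable_funX; exact: measurable_sqrt_sqnorm.
    apply: measurableT_comp => //; apply: measurable_funM => //.
    apply: measurableT_comp => //; apply: measurable_funM => //.
    exact: measurable_sqnorm.
  - by move=> v _; rewrite lee_fin mulr_ge0 ?exprn_ge0 ?sqrtr_ge0 ?expR_ge0.
  - by rewrite lee_fin mulr_ge0.
  by rewrite scaling -/Psi !EFinM muleACA.
rewrite ge0_integralZr; last 4 first.
- exact: measurableT.
- apply/measurable_EFinP; apply: measurable_funM; first exact: measurable_indic.
  exact: measurable_t_kernel.
- by move=> t _; rewrite lee_fin mulr_ge0// t_kernel_ge0.
- by rewrite mule_ge0.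
rewrite muleC muleA; congr (_ * _)%E.
rewrite [RHS]integral_mkcond; apply: eq_integral => t _.
rewrite patchE indicE; case: ifP => _; first by rewrite mul1r.
by rewrite mul0r.
Qed.

Hypothesis m0 : (0 < m)%N.
Hypothesis n0 : (0 < n)%N.

Lemma normal_prob_set1 (x : R) : N01 [set x] = 0%E.
Proof. by rewrite /normal_prob integral_set1. Qed.

(** For [v] of norm 0 the scaled density vanishes identically, and [m0] provides at least one factor
    of the product. *)
Lemma ratio_integrand0 (Q : nat -> set RR) (v : n.-tuple R) : sqnorm v = 0 ->
  (\prod_(j < m) \int[mu]_x
     (\1_(Q j) x * scaled_normal_pdf zeta (Num.sqrt (sqnorm v)) x)%:E = 0)%E.
Proof.
move=> v0; rewrite (bigD1 (Ordinal m0))//= v0 sqrtr0 integral0_eq ?mul0e// => x _.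
by rewrite /scaled_normal_pdf !mul0r normr0 mul0r mulr0.
Qed.

Lemma ratio_probT : ratio_prob (fun=> setT) = 1%E.
Proof.
(* [Z] contains only the origin. It is a null set because [n] is positive; outside it every factor
   of the integrand is a total probability, hence 1. *)
pose Z := [set v : n.-tuple R | forall i, [set (0 : RR)] (tnth v i)].
have mZ : measurable Z by exact: (@measurable_tuple_box R n (fun=> [set 0])).
have Z0 : gauss_tuple n Z = 0%E.
  rewrite (@gauss_tuple_box R n (fun=> [set 0]))//.
  by rewrite (bigD1 (Ordinal n0))//= normal_prob_set1 mul0e.
have sqnorm0 (v : n.-tuple R) : sqnorm v = 0 <-> Z v.
  split=> [/eqP|Zv]; last by rewrite /sqnorm big1// => i _; rewrite Zv expr0n.
  rewrite psumr_eq0 => [/allP H i /=|i _]; last exact: sqr_ge0.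
  by have := H i (mem_index_enum _); rewrite sqrf_eq0 => /eqP.
transitivity (\int[gauss_tuple n]_v (\1_(~` Z) v)%:E)%E.
  apply: eq_integral => v _; rewrite indicE in_setC.
  have [vZ|vZ] := boolP (v \in Z).
    by apply: (ratio_integrand0 (fun=> setT)); apply/sqnorm0; rewrite inE in vZ.
  rewrite big1// => j _; rewrite -normal_prob_scale//.
    by rewrite (_ : [set x | _] = setT) ?probability_setT//; apply/seteqP; split.
  rewrite sqrtr_eq0 -ltNge lt_neqAle sqnorm_ge0 andbT eq_sym.
  by apply: contra vZ => /eqP/sqnorm0 vZ; rewrite inE.
rewrite integral_indic; [|exact: measurableT|exact: measurableC].
rewrite setIT; transitivity (1 - gauss_tuple n Z)%E; last by rewrite Z0 sube0.
exact: probability_setC.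
Qed.

(** By [ratio_probT], [ratio_const] normalizes the kernel as well, so it equals [c]. *)
Lemma ratio_prob_density (c : \bar R) Q : (forall j, measurable (Q j)) ->
  (c * \int[lebesgue_tuple m]_t (t_kernel t)%:E = 1)%E ->
  (ratio_prob Q = c * \int[lebesgue_tuple m]_(t in
    [set t : m.-tuple R | forall j, Q (j : 'I_m) (tnth t j)]) (t_kernel t)%:E)%E.
Proof.
move=> mQ c1; rewrite ratio_prob_kernel//; congr (_ * _)%E.
apply: mule_eq1_unique c1; rewrite -ratio_probT ratio_prob_kernel//.
by congr (_ * integral _ _ _)%E; apply/seteqP; split.
Qed.

End kernel.

(** * The images of a Gaussian matrix that meet a box *)

Lemma integral_probability_cst d (T : measurableType d) (R : realType)
    (P : probability T R) (c : \bar R) : (\int[P]_x (cst c x) = c)%E.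
Proof.
rewrite integral_cst//; transitivity (c * 1)%E; last by rewrite mule1.
congr (_ * _)%E; exact: probability_setT.
Qed.

Section hits.
Context {R : realType}.
Local Notation mu := (@lebesgue_measure R).
Local Notation RR := (measurableTypeR R).
Local Notation N01 := (@normal_prob R 0 1).

Definition consrow m n (t : n.-tuple R) (M : 'M[R]_(m, n)) : 'M[R]_(m.+1, n) :=
  \matrix_(i, j) if unlift ord0 i is Some i' then M i' j else tnth t j.

Lemma consrow0 m n (t : n.-tuple R) (M : 'M[R]_(m, n)) j :
  consrow t M ord0 j = tnth t j.
Proof. by rewrite mxE unlift_none. Qed.

Lemma consrowS m n (t : n.-tuple R) (M : 'M[R]_(m, n)) i j :
  consrow t M (lift ord0 i) j = M i j.
Proof. by rewrite mxE liftK. Qed.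

Section one_space.
Context d (T : measurableType d) (P : probability T R).

Lemma measurable_consrow m n (X : T -> 'M[R]_(m.+1, n)) :
  (forall i j, measurable_fun setT (fun w => X w i j : RR)) ->
  measurable_fun setT
    (fun z : n.-tuple R * T => consrow z.1 (row' ord0 (X z.2)) : borel_mx m.+1 n).
Proof.
move=> mX; apply: measurable_fun_mx => i j.
under eq_fun do rewrite mxE.
case: (unliftP ord0 i) => [i' _|_].
  under eq_fun do rewrite mxE.
  exact: measurableT_comp (mX _ _) measurable_snd.
exact: measurableT_comp (measurable_tnth j) measurable_fst.
Qed.

(** The first row is independent of the others, so it may be drawn afresh from [gauss_tuple]: both
    laws agree on rectangles. Disintegration of the product measure then conditions on that row. *)
Lemma gaussian_mx_split m n (X : T -> 'M[R]_(m.+1, n)) (E : set (borel_mx m.+1 n)) :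
  gaussian_mx P X -> measurable E ->
  (P (X @^-1` E) =
   \int[gauss_tuple n]_t P [set w | E (consrow t (row' ord0 (X w)))])%E.
Proof.
move=> gX mE; have [mX PX] := gX.
have mf := measurable_consrow mX.
have [_ PX'] := gaussian_mx_row' gX.
transitivity ((gauss_tuple n \x P)%E
    ((fun z => consrow z.1 (row' ord0 (X z.2))) @^-1` E)).
  apply: (@borel_mx_measure_unique _ _ _ (image_measure P (measurable_fun_mx mX))
    (image_measure (gauss_tuple n \x P)%E mf)) => //; last first.
    by rewrite /= /pushforward preimage_setT probability_setT ltry.
  move=> B mB; rewrite /= /pushforward/= [LHS]PX//.
  pose B' i j := B (lift ord0 i) j.
  transitivity ((gauss_tuple n \x P)%E
    ([set t | forall j, B ord0 j (tnth t j)] `*`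
     [set w | forall i j, B' i j ((row' ord0 (X w)) i j)])).
    rewrite product_measure1E; last 2 first.
    - exact: (measurable_tuple_box (fun j => mB ord0 j)).
    - apply: measurable_rect => i j; last exact: mB.
      by under eq_fun do rewrite mxE; exact: mX.
    rewrite big_ord_recl; apply: congr2.
      by rewrite -(gauss_tuple_box (fun j => mB ord0 j)).
    by apply/esym/PX' => i j; exact: mB.
  congr (_ _); apply/seteqP; split => [[t w] [/= Ht Hw] i j|[t w] /= H].
    case: (unliftP ord0 i) => [i' ->|->]; first by rewrite consrowS; exact: Hw.
    by rewrite consrow0; exact: Ht.
  split=> [j|i j] /=; first by have := H ord0 j; rewrite consrow0.
  by have := H (lift ord0 i) j; rewrite consrowS.
apply: eq_integral => t _ /=; congr (P _).
by apply/seteqP; split => w; rewrite /xsection/= inE.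
Qed.

Lemma measurable_consrow_prob m n (X : T -> 'M[R]_(m.+1, n)) (E : set (borel_mx m.+1 n)) :
  gaussian_mx P X -> measurable E ->
  measurable_fun setT (fun t => P [set w | E (consrow t (row' ord0 (X w)))]).
Proof.
move=> [mX _] mE.
have := measurable_fun_xsection P (measurable_preimageT (measurable_consrow mX) mE).
congr (measurable_fun _ _); apply/funext => t /=; congr (P _).
by apply/seteqP; split => w; rewrite /xsection/= inE.
Qed.

Lemma measurable_consrow_set m n (X : T -> 'M[R]_(m.+1, n)) (E : set (borel_mx m.+1 n)) t :
  (forall i j, measurable_fun setT (fun w => X w i j : RR)) -> measurable E ->
  measurable [set w | E (consrow t (row' ord0 (X w)))].
Proof.
move=> mX mE.
have := measurable_xsection t (measurable_preimageT (measurable_consrow mX) mE).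
by congr measurable; apply/seteqP; split => w; rewrite /xsection/= inE.
Qed.

End one_space.

(** Indexing the constraints by [nat] turns the deletion of the first row into a shift of [C]. *)
Definition hits m n (C : nat -> set R) : set 'M[R]_(m, n) :=
  [set M | exists y : 'cV[R]_n, forall i : 'I_m, C i ((M *m y) i 0)].

Lemma measurable_hits_box m n (C : nat -> set R) : (forall k, closed (C k)) ->
  measurable (hits C : set (borel_mx m n)).
Proof.
move=> cC.
suff cK : closed [set x : 'cV[R]_m | forall i : 'I_m, C i (x i 0)].
  exact: (measurable_hits cK).
have -> : [set x : 'cV[R]_m | forall i : 'I_m, C i (x i 0)] =
    \bigcap_(i in [set: 'I_m]) ((fun x : 'cV[R]_m => x i 0) @^-1` C i).
  by apply/seteqP; split => x /= H; [move=> i _; exact: H|move=> i; exact: (H i)].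
apply: closed_bigI => i _; apply: preimage_closed => // x _.
exact: coord_continuous.
Qed.

Section one_space.
Context d (T : measurableType d) (P : probability T R).

Lemma hits_step m n (X : T -> 'M[R]_(m.+1, n.+1)) (C : nat -> set R) :
  gaussian_mx P X -> (forall k, closed (C k)) -> C 0%N = [set 0] ->
  (P [set w | hits (fun k => C k.+1) (col' ord0 (row' ord0 (X w)))] <=
   P [set w | hits C (X w)])%E.
Proof.
move=> gX cC C0.
have mC' : measurable (hits (fun k => C k.+1) : set (borel_mx m n)).
  by apply: measurable_hits_box => k; exact: cC.
have mC : measurable (hits C : set (borel_mx m.+1 n.+1)) by exact: measurable_hits_box.
have gX' := gaussian_mx_row' gX; have gX'' := gaussian_mx_col' gX'.
rewrite [leRHS](gaussian_mx_split gX mC).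
(* The left side is written as the integral of a constant, so that the comparison can be made for
   each fixed first row [t]. *)
set p := P _.
have -> : p = (\int[gauss_tuple n.+1]_t (cst p t))%E.
  by rewrite integral_probability_cst.
apply: ge0_le_integral => //; first exact: measurable_consrow_prob.
move=> t _.
have [H [gH _ [r vH] _]] := rotation_to_axis (\row_j tnth t j) ord0.
have gXH := gaussian_mx_col' (gH _ _ _ _ _ gX').
(* The rotation depends on [t] but is fixed once [t] is, so rotating the remaining rows does not
   change the law. *)
rewrite /p [X in (X <= _)%E](gaussian_mx_law gX'' gXH mC').
apply: le_measure; rewrite ?inE.
- exact: measurable_preimageT (measurable_fun_mx gXH.1) mC'.
- exact: measurable_consrow_set gX.1 mC.
move=> w [y Hy]; set M := row' ord0 (X w) in Hy *.
(* A solution of the smaller system is padded with 0 in the only coordinate seen by the rotated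
   first row, which therefore vanishes on it. *)
pose y' : 'cV[R]_n.+1 := \col_i if unlift ord0 i is Some i' then y i' 0 else 0.
exists (H *m y') => i; case: (unliftP ord0 i) => [i' ->|->].
  have := Hy i'; congr (C _ _); rewrite [RHS]mxE.
  transitivity ((M *m H *m y') i' 0).
    rewrite !mxE big_ord_recl !mxE unlift_none mulr0 add0r.
    by apply: eq_bigr => j _; rewrite !mxE liftK.
  rewrite -mulmxA mxE; apply: eq_bigr => j _.
  by rewrite consrowS.
rewrite C0 /=; transitivity (((\row_j tnth t j) *m H *m y') 0 0).
  rewrite -mulmxA [LHS]mxE [RHS]mxE; apply: eq_bigr => j _.
  by rewrite consrow0 [in RHS]mxE.
rewrite vH -scalemxAl mxE -rowE !mxE.
by rewrite unlift_none mulr0.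
Qed.

(** [rotation_to_axis] leaves the sign of [r] undetermined; the normal density is even. *)
Lemma scaled_normal_pdf_norm (zeta r x : R) :
  scaled_normal_pdf zeta `|r| x = scaled_normal_pdf zeta r x.
Proof.
have sqE : (`|r| / zeta * x) ^+ 2 = (r / zeta * x) ^+ 2.
  by rewrite !exprMn real_normK ?num_real.
by rewrite /scaled_normal_pdf !phiE sqE !normrM normr_id.
Qed.

Lemma hits_base m n (X : T -> 'M[R]_(m.+1, n)) (C : nat -> set R) zeta :
  (0 < m)%N -> (0 < n)%N -> zeta != 0 ->
  gaussian_mx P X -> (forall k, closed (C k)) -> C 0%N = [set zeta] ->
  (ratio_prob zeta m n (fun j => C j.+1) <= P [set w | hits C (X w)])%E.
Proof.
move=> m0 n0 z0 gX cC C0.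
have mCk k : measurable (C k : set RR) by exact: closed_measurable.
have mC : measurable (hits C : set (borel_mx m.+1 n)) by exact: measurable_hits_box.
have gX' := gaussian_mx_row' gX.
rewrite [leRHS](gaussian_mx_split gX mC).
apply: ge0_le_integral => //.
- move=> t _; apply: prode_ge0 => j _; apply: integral_ge0 => x _.
  by rewrite lee_fin mulr_ge0// scaled_normal_pdf_ge0.
- exact: (@measurable_ratio_integrand R zeta m n (fun j => C j.+1) (fun j => mCk j.+1)).
- exact: measurable_consrow_prob.
move=> t _.
(* A zero first row cannot meet the constraint [zeta], but there the integrand on the left is 0. *)
have [t0|t0] := eqVneq (sqnorm t) 0.
  have := ratio_integrand0 zeta m0 (fun j => C j.+1) t0; by move=> ->.
pose v := \row_j tnth t j.
have [H [gH oH [r vH] _]] := rotation_to_axis v (Ordinal n0).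
have r2 : sqnorm t = r ^+ 2.
  transitivity ((v *m v^T) 0 0).
    by rewrite !mxE; apply: eq_bigr => j _; rewrite !mxE.
  have -> : v *m v^T = (v *m H) *m (v *m H)^T.
    by rewrite trmx_mul mulmxA -(mulmxA v) oH mulmx1.
  rewrite vH mxE (bigD1 (Ordinal n0))//= big1 => [|j /negPf jn].
    by rewrite !mxE !eqxx /= !mulr1 addr0 expr2.
  by rewrite !mxE jn andbF mulr0 mul0r.
have r0 : r != 0 by move: t0; rewrite r2 sqrf_eq0.
pose Q (j : nat) : set RR := [set x | C j.+1 (zeta / r * x)].
have mQ j : measurable (Q j).
  apply: (@measurable_preimageT _ _ RR RR (fun x => zeta / r * x)) => //.
  exact: measurable_funM.
(* After the rotation only the column of index 0 of the remaining rows is constrained, and its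
   entries are independent N(0,1). *)
pose B (i : 'I_m) (j : 'I_n) := if j == Ordinal n0 then Q i else setT.
have mB i j : measurable (B i j) by rewrite /B; case: ifP.
have gXH := gH _ _ _ _ _ gX'.
have -> : (\prod_(j < m) \int[mu]_x
    (\1_(C j.+1) x * scaled_normal_pdf zeta (Num.sqrt (sqnorm t)) x)%:E =
    P [set w | forall i j, B i j ((row' ord0 (X w) *m H) i j)])%E.
  rewrite gXH.2//; apply: eq_bigr => i _.
  rewrite (bigD1 (Ordinal n0))//= big1 ?mule1 => [|j /negPf jn]; last first.
    by rewrite /B jn probability_setT.
  rewrite /B eqxx (normal_prob_scale z0 r0 (mCk i.+1)); apply: eq_integral => x _.
  by rewrite r2 sqrtr_sqr scaled_normal_pdf_norm.
apply: le_measure; rewrite ?inE.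
- by apply: measurable_rect => //; exact: gXH.1.
- exact: measurable_consrow_set gX.1 mC.
(* The first row becomes [r] times the first axis vector, so this multiple gives it the value
   [zeta]. *)
pose y : 'cV[R]_n := (zeta / r) *: delta_mx (Ordinal n0) 0.
move=> w Hw; exists (H *m y) => i.
case: (unliftP ord0 i) => [i' ->|->].
  have := Hw i' (Ordinal n0); rewrite /B eqxx /Q /=; congr (C _ _).
  transitivity ((row' ord0 (X w) *m (H *m y)) i' 0).
    by rewrite /y -!scalemxAr mulmxA -colE [RHS]mxE [in RHS]mxE.
  by rewrite [LHS]mxE [RHS]mxE; apply: eq_bigr => j _; rewrite consrowS.
rewrite C0 /=; transitivity ((v *m H *m y) 0 0).
  rewrite -mulmxA [LHS]mxE [RHS]mxE; apply: eq_bigr => j _.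
  by rewrite consrow0 [in RHS]mxE.
rewrite vH /y -scalemxAl -scalemxAr mul_delta_mx !mxE !eqxx mulr1.
by rewrite mulrC divfK.
Qed.

End one_space.

(** Induction on the number [k] of zero constraints. The sizes are sums starting with [k], so that a
    successor of [k] exposes the row and the column removed by [hits_step]. *)
Lemma hits_ge k m n d (T : measurableType d) (P : probability T R)
    (X : T -> 'M[R]_(k + m.+1, k + n)) (C : nat -> set R) zeta :
  (0 < m)%N -> (0 < n)%N -> zeta != 0 ->
  gaussian_mx P X -> (forall i, closed (C i)) ->
  (forall i, (i < k)%N -> C i = [set 0]) -> C k = [set zeta] ->
  (ratio_prob zeta m n (fun j => C (k + j.+1)%N) <= P [set w | hits C (X w)])%E.
Proof.
move=> m0 n0 z0; elim: k X C => [|k IH] X C gX cC Ci Ck; first exact: hits_base.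
apply: le_trans (hits_step gX cC _); last exact: Ci.
apply: (IH _ (fun i => C i.+1)) => //.
- exact: gaussian_mx_col' (gaussian_mx_row' gX).
- by move=> i ik; exact: Ci.
Qed.

End hits.

(** * The reduced problem *)

Lemma gaussian_matrix_mx (R : realType) d (T : measurableType d)
    (P : probability T R) m n (A : 'I_m -> 'I_n -> {RV P >-> R}) :
  gaussian_matrix P A -> gaussian_mx P (sample_matrix A).
Proof.
move=> [dA iA]; split=> [i j|B mB].
  by under eq_fun do rewrite mxE; exact: (measurable_funPT (A i j)).
pose B' (ij : 'I_m * 'I_n) := B ij.1 ij.2.
have := iA [set: 'I_m * 'I_n]%SET B' (fun ij => mB _ _).
rewrite pair_bigA => PA; transitivity (\prod_(ij in [set: 'I_m * 'I_n]%SET)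
    P (A ij.1 ij.2 @^-1` B' ij))%E.
  rewrite -PA; congr (P _); apply/seteqP; split => w H.
    by move=> ij _; have := H ij.1 ij.2; rewrite mxE.
  by move=> i j; rewrite mxE; apply: (H (i, j)); rewrite inE.
apply: eq_big => [ij|ij _]; first by rewrite inE.
exact: (dA ij.1 ij.2 _ (mB ij.1 ij.2)).
Qed.

Lemma col_sum_delta (R : realType) n (v : 'cV[R]_n) :
  v = \sum_i v i 0 *: (delta_mx i 0 : 'cV[R]_n).
Proof.
apply/colP => i; rewrite summxE (bigD1 i)//= big1 => [|j ji].
  by rewrite !mxE !eqxx mulr1 addr0.
by rewrite !mxE eq_sym (negPf ji) mulr0.
Qed.

Section subspaces.
Context {R : realType}.

Lemma topprojE n k (x : 'cV[R]_n) i : topproj k x i 0 = if (i < k)%N then x i 0 else 0.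
Proof.
rewrite /topproj /Umx tr_pid_mx pid_mx_id// mxE (bigD1 i)//= mxE eqxx/=.
rewrite big1 ?addr0 => [|j ji]; last first.
  by rewrite mxE val_eqE eq_sym (negPf ji) mul0r.
by case: ifP; rewrite ?mul1r ?mul0r.
Qed.

Lemma topproj_colspan n k (x : 'cV[R]_n) : topproj k x \in colspan (Umx n k).
Proof.
rewrite /topproj -mulmxA; set y := _ *m x.
rewrite (_ : _ *m y = \sum_j y j 0 *: col j (Umx n k)); last first.
  apply/colP => i; rewrite mxE summxE; apply: eq_bigr => j _.
  by rewrite !mxE mulrC.
apply: memv_suml => j _; apply: memvZ; apply: memv_span.
by apply: map_f; rewrite mem_enum.
Qed.

Lemma colspan_Umx0 n k (u : 'cV[R]_n) (i : 'I_n) :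
  u \in colspan (Umx n k) -> (k <= i)%N -> u i 0 = 0.
Proof.
rewrite /colspan; set l := [seq _ | j <- _] => uT ki.
rewrite (coord_span (X := in_tuple l) uT) summxE big1// => j _.
have /mapP[h _ lj] : l`_j \in l by apply: mem_nth; exact: ltn_ord j.
by rewrite mxE /= lj !mxE ltnNge ki andbF mulr0.
Qed.

(** The remainder [x - topproj k x] vanishes on the first [k] coordinates and members of the column
    span vanish on the others, so the two are orthogonal. *)
Lemma constant_topproj n k (f : 'cV[R]_n -> R) x :
  constant_along_orthc f (colspan (Umx n k)) -> f x = f (topproj k x).
Proof.
move=> cf; rewrite -[x in LHS](subrKC (topproj k x)).
apply: cf; first exact: topproj_colspan.
move=> u uT; apply: big1 => i _; rewrite mxE [X in _ + X]mxE topprojE.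
case: ltnP => [ik|ki]; first by rewrite subrr mulr0.
by rewrite (colspan_Umx0 uT)// mul0r.
Qed.

End subspaces.

Section t_pdf.
Context {R : realType}.

Lemma Gamma_ge0 (a : R) : 0 <= Gamma a.
Proof.
by apply: Rintegral_ge0 => x _; rewrite mulr_ge0 ?powR_ge0 ?expR_ge0.
Qed.

(** Only the squares of [e] and [zeta] are related, since [zeta] will be a rotated coordinate whose
    sign is unknown. *)
Lemma t_pdf_kernel m n (e zeta : R) : zeta != 0 -> zeta ^+ 2 = e ^+ 2 ->
  exists2 c : R, 0 <= c & forall t : m.-tuple R,
    t_pdf n.+1%:R ((e ^+ 2 / n.+1%:R)%:M) (tuple_col t) = c * t_kernel zeta n.+1 t.
Proof.
move=> z0 ze.
exists (((pi * n.+1%:R) `^ (m%:R / 2))^-1 *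
  (Gamma ((m%:R + n.+1%:R) / 2) / Gamma (n.+1%:R / 2)) *
  (\det ((e ^+ 2 / n.+1%:R)%:M : 'M[R]_m)) `^ (- (1 / 2))).
  by rewrite !mulr_ge0 ?powR_ge0 ?invr_ge0 ?powR_ge0 ?Gamma_ge0.
move=> t; rewrite /t_pdf /t_kernel; congr (_ * (1 + _) `^ _).
rewrite invmx_scalar mul_mx_scalar -scalemxAl mxE.
have -> : ((tuple_col t)^T *m tuple_col t) 0 0 = sqnorm t.
  by rewrite mxE; apply: eq_bigr => i _; rewrite !mxE expr2.
rewrite -ze; field.
by rewrite z0 addrC natr1 pnatr_eq0.
Qed.

End t_pdf.

Lemma closed_box (R : realType) D : closed (@box R D).
Proof.
have -> : @box R D = \bigcap_(i in [set: 'I_D])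
    ((fun x : 'cV[R]_D => x i 0) @^-1` `[-1, 1]%classic).
  apply/seteqP; split => x H; first by move=> i _; rewrite /= in_itv/=; exact: H.
  by move=> i; have := H i I; rewrite /= in_itv.
apply: closed_bigI => i _; apply: preimage_closed => [x _|].
  exact: coord_continuous.
exact: interval_closed.
Qed.

(** After translation by [p], success means that the range of the matrix meets the closed set [K],
    to which [measurable_hits] applies. *)
Lemma measurable_RPX_successful (R : realType) d (T : measurableType d) D n
    (X : T -> 'M[R]_(D, n)) (f : 'cV[R]_D -> R) (m : R) (p : 'cV[R]_D) :
  (forall i j, measurable_fun setT (fun w => X w i j : measurableTypeR R)) ->
  continuous f -> measurable [set w | RPX_successful f box m (X w) p].
Proof.
move=> mX cf.
pose K := [set x | f (x + p) = m] `&` [set x | box (x + p)].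
have cK : closed K.
  have cadd : continuous (fun x : 'cV[R]_D => x + p).
    move=> x; apply: cvgD.
    - exact: nbhs_filter.
    - exact: cvg_id.
    - apply: cvg_cst; exact: nbhs_filter.
  apply: closedI; last by apply: preimage_closed => [x _|]; [exact: cadd|exact: closed_box].
  suff : closed ((fun x => f (x + p)) @^-1` [set m]) by [].
  apply: preimage_closed => [x _|]; last exact: closed_eq.
  exact: (continuous_comp (cadd x) (cf (x + p))).
exact: measurable_preimageT (measurable_fun_mx mX) (measurable_hits cK).
Qed.

(** The sizes in the theorem split into the required sums only by provable equations; substituting
    them here avoids casts on matrices. *)
Lemma hits_ge_cast (R : realType) k m n a b d (T : measurableType d)
    (P : probability T R) (X : T -> 'M[R]_(a, b)) (C : nat -> set R) zeta :
  a = (k + m.+1)%N -> b = (k + n)%N ->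
  (0 < m)%N -> (0 < n)%N -> zeta != 0 ->
  gaussian_mx P X -> (forall i, closed (C i)) ->
  (forall i, (i < k)%N -> C i = [set 0]) -> C k = [set zeta] ->
  (ratio_prob zeta m n (fun j => C (k + j.+1)%N) <= P [set w | hits C (X w)])%E.
Proof. by move=> aE bE; subst a b; exact: hits_ge. Qed.

Theorem theorem3p7 (R : realType)
    (dO dO' : measure_display)
    (Omega : measurableType dO) (P : probability Omega R)
    (Omega' : measurableType dO') (P' : probability Omega' R)
    (D d de : nat) (de_lt_D : (de < D)%N) (de_le_d : (de <= d)%N)
    (f : 'cV[R]_D -> R) (f_cont : continuous f)
    (T : {vspace 'cV[R]_D}) (T_eff : effective_subspace f de T)
    (T_U : T = colspan (Umx D de))
    (T_V : orthc T = [set x | x \in colspan (Vmx D de)])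
    (fstar : R) (fstar_min : minimum_value f box fstar)
    (xstar : 'cV[R]_D) (xstar_min : global_minimizer f box xstar)
    (p : 'cV[R]_D) (p_box : box p)
    (A : 'I_D -> 'I_d -> {RV P >-> R}) (A_gauss : gaussian_matrix P A)
    (p_neq : topproj de p <> topproj de xstar)
    (W : {RV P' >-> (D - de).-tuple R})
    (W_t : has_t_distribution P' W (d - de + 1)%:R
       ((enorm (topproj de xstar - topproj de p) ^+ 2 / (d - de + 1)%:R)%:M)) :
  (P [set w | RPX_successful f box fstar (sample_matrix A w) p] >=
   P' [set w | forall j : 'I_(D - de),
         (- 1 - tailv de p j 0 <= tnth (W w) j <= 1 - tailv de p j 0)%R])%E.
Proof.
pose z : 'rV[R]_D := (topproj de xstar - topproj de p)^T.
have zE i : z 0 i = if (i < de)%N then xstar i 0 - p i 0 else 0.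
  rewrite mxE mxE [X in _ + X]mxE !topprojE.
  by case: ifP => // _; rewrite subrr.
have z0 : z != 0.
  apply/eqP => z0; apply: p_neq; apply/esym/eqP; rewrite -subr_eq0.
  by rewrite -[X in X == 0]trmxK -/z z0 trmx0.
(* With [de] equal to 0 both projections would vanish, against [p_neq]. *)
have de0 : (0 < de)%N.
  rewrite lt0n; apply: contraNneq z0 => de0; apply/eqP/rowP => i.
  by rewrite zE de0 ltn0 mxE.
(* The axis is the last effective coordinate, of index [de.-1], so that the zero constraints precede
   the nonzero one as in [hits_ge]. *)
have kD : (de.-1 < D)%N by rewrite prednK// ltnW.
pose k0 := Ordinal kD.
have [H [gH oH [r zH] fixH]] := rotation_to_axis z k0.
pose e := enorm (topproj de xstar - topproj de p).
have re : r ^+ 2 = e ^+ 2.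
  rewrite /e /enorm sqr_sqrtr ?sumr_ge0// => [|i _]; last exact: sqr_ge0.
  transitivity ((z *m z^T) 0 0).
    have -> : z *m z^T = (z *m H) *m (z *m H)^T.
      by rewrite trmx_mul mulmxA -(mulmxA z) oH mulmx1.
    rewrite zH mxE (bigD1 k0)//= big1 => [|j /negPf jn].
      by rewrite !mxE !eqxx /= !mulr1 addr0 expr2.
    by rewrite !mxE jn andbF mulr0 mul0r.
  by rewrite mxE; apply: eq_bigr => i _; rewrite [z^T]trmxK [z 0 i]mxE expr2.
have zHr : z^T = H *m (r *: delta_mx k0 0).
  have : (z *m H *m H^T)^T = z^T by rewrite -mulmxA oH mulmx1.
  by move=> <-; rewrite zH trmx_mul trmxK; congr (_ *m _); apply/matrixP => i j; rewrite !mxE andbC.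
have r0 : r != 0.
  apply: contraNneq z0 => r0; rewrite -[z]trmxK zHr r0 scale0r mulmx0.
  by rewrite trmx0.
(* [p] is extended to all of [nat]; the default 0 only serves to make [C] total. *)
pose pn (i : nat) : R := if insub i is Some i' then p i' 0 else 0.
have pnE (i : 'I_D) : pn i = p i 0 by rewrite /pn valK.
(* These are the constraints on the rotated image [H^T *m A *m y]: it equals [r] times the axis
   vector on the effective coordinates, and the shifted box bounds the others. *)
pose C (i : nat) : set R := if (i < de.-1)%N then [set 0]
  else if i == de.-1 then [set r] else `[- 1 - pn i, 1 - pn i]%classic.
have cC i : closed (C i).
  rewrite /C; case: ifP => _; first exact: closed_eq.
  by case: ifP => _; [exact: closed_eq|exact: interval_closed].
have gA := gaussian_matrix_mx A_gauss.
(* Rotating rows is rotating columns of the transpose. *)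
have gX : gaussian_mx P (fun w => H^T *m sample_matrix A w).
  have := gaussian_mx_tr (gH _ _ _ _ _ (gaussian_mx_tr gA)).
  by congr (gaussian_mx P _); apply/funext => w; rewrite trmx_mul trmxK.
have fE x : f x = f (topproj de x).
  by apply: constant_topproj; rewrite -T_U; case: T_eff.
have fstarE : fstar = f xstar.
  have [[x Xx <-] min] := fstar_min; have [Xs smin] := xstar_min.
  by apply/eqP; rewrite eq_le smin//= (min _ Xs).
have incl : [set w | hits C (H^T *m sample_matrix A w)] `<=`
    [set w | RPX_successful f box fstar (sample_matrix A w) p].
  move=> w [y Hy]; exists y; set x := sample_matrix A w *m y.
  pose u := H^T *m x.
  have uE (i : 'I_D) : C i (u i 0) by have := Hy i; rewrite -mulmxA.
  have xu : x = H *m u by rewrite /u mulmxA oH mul1mx.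
  pose tl : 'cV[R]_D := \col_i if (i < de)%N then 0 else u i 0.
  have ut : u = r *: delta_mx k0 0 + tl.
    apply/colP => i; rewrite [RHS]mxE [X in _ = X + _]mxE [delta_mx _ _ _ _]mxE.
    rewrite [X in _ = _ + X]mxE eqxx andbT.
    have := uE i; rewrite /C -val_eqE /=; case: ltngtP => [ik|ik|ik].
    - by move=> ->; rewrite (leq_trans ik (leq_pred _)) mulr0 addr0.
    - have dei : (de <= i)%N by rewrite -(prednK de0).
      by move=> _; rewrite ltnNge dei mulr0 add0r.
    - by move=> ->; rewrite (_ : (i < de)%N) ?mulr1 ?addr0// ik ltn_predL.
  (* [z] vanishes at every index from [de] on and none of them is [k0], so the last clause of
     [rotation_to_axis] makes [H] fix these axis vectors and hence [tl]. *)
  have Htl : H *m tl = tl.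
    rewrite [X in H *m X = _]col_sum_delta [RHS]col_sum_delta mulmx_sumr.
    apply: eq_bigr => i _; rewrite -scalemxAr; case: (ltnP i de) => ide.
      by rewrite (_ : tl i 0 = 0) ?scale0r// mxE ide.
    rewrite fixH//; last by rewrite zE ltnNge ide.
    by rewrite -val_eqE/= gtn_eqF// prednK.
  (* Thus [x] moves the effective part of [p] exactly onto that of [xstar] and changes the other
     coordinates by those of [u]. *)
  have xE : x = z^T + tl by rewrite xu ut mulmxDr -zHr Htl.
  have xtop (i : 'I_D) : (i < de)%N -> (x + p) i 0 = xstar i 0.
    by move=> ide; rewrite mxE xE mxE [z^T i 0]mxE zE [tl i 0]mxE ide addr0 subrK.
  have xbot (i : 'I_D) : (de <= i)%N -> (x + p) i 0 = u i 0 + p i 0.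
    by move=> ide; rewrite mxE xE mxE [z^T i 0]mxE zE [tl i 0]mxE ltnNge ide add0r.
  split.
    rewrite fE fstarE (fE xstar); congr f; apply/colP => i; rewrite !topprojE.
    by case: ifP => // /xtop.
  move=> i; case: (ltnP i de) => ide; first by rewrite xtop//; exact: xstar_min.1.
  rewrite xbot//; have := uE i; rewrite /C pnE.
  rewrite ltnNge (leq_trans (leq_pred _) ide)/=.
  rewrite gtn_eqF ?prednK//= in_itv/= => /andP[u1 u2].
  by rewrite -lerBlDr u1/= -lerBrDr.
apply: (@le_trans _ _ (P [set w | hits C (H^T *m sample_matrix A w)])); last first.
  apply: le_measure incl; rewrite ?inE.
  - exact: measurable_preimageT (measurable_fun_mx gX.1) (measurable_hits_box cC).
  - exact: measurable_RPX_successful gA.1 f_cont.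
(* There are [de.-1] zero constraints, one constraint [r] and [D - de] bounded rows; after the
   deletions [(d - de).+1] columns remain. *)
apply: le_trans (@hits_ge_cast R de.-1 (D - de) (d - de).+1 D d _ _ P _ C r
  _ _ _ _ r0 gX cC _ _); last 6 first.
- by rewrite addnS -addSn prednK// subnKC// ltnW.
- by rewrite addnS -addSn prednK// subnKC.
- by rewrite subn_gt0.
- by [].
- by move=> i ik; rewrite /C ik.
- by rewrite /C ltnn eqxx.
rewrite addn1 in W_t.
have [c c0 cE] := @t_pdf_kernel R (D - de) (d - de) e r r0 re.
pose Q (j : nat) : set (measurableTypeR R) := C (de.-1 + j.+1)%N.
have mQ j : measurable (Q j) by exact: (closed_measurable (cC _)).
pose box' := [set t : (D - de).-tuple R | forall j : 'I_(D - de), Q j (tnth t j)].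
have mbox : measurable box'.
  exact: (@measurable_tuple_box R (D - de) (fun j => Q j) (fun j => mQ j)).
have PW B : measurable B -> (P' (W @^-1` B) =
    c%:E * \int[lebesgue_tuple (D - de)]_(t in B) (t_kernel r (d - de).+1 t)%:E)%E.
  move=> mB; rewrite -[LHS]/(distribution P' W B) W_t//.
  under eq_integral do rewrite cE EFinM.
  rewrite ge0_integralZl//.
  - by apply: measurable_funTS; apply/measurable_EFinP; exact: measurable_t_kernel.
  - by move=> t _; rewrite lee_fin t_kernel_ge0.
rewrite (@ratio_prob_density _ _ _ _ r0 _ _ c%:E); last 4 first.
- by rewrite subn_gt0.
- by [].
- exact: mQ.
(* The normalization of [c] is the total mass 1 of the law of [W]; no Gamma function is
   evaluated. *)
- by rewrite -PW// preimage_setT probability_setT.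
have QE (j : 'I_(D - de)) x :
    Q j x = (- 1 - tailv de p j 0 <= x <= 1 - tailv de p j 0) :> Prop.
  (* The shift past the [r] constraint makes [de.-1 + j.+1] equal to [de + j], the index of the tail
     entry [j]. *)
  have tE : (de.-1 + j.+1)%N = tail_ord j by rewrite addnS -addSn prednK.
  rewrite /Q /C tE /tailv [(\col__ _) _ _]mxE pnE -tE ltnNge leq_addr/=.
  by rewrite -[X in _ == X]addn0 eqn_add2l/= in_itv.
rewrite -PW// le_eqVlt; apply/orP; left; apply/eqP; congr (P' _).
apply/seteqP; split => w Hw j; have := Hw j; first by rewrite -QE.
by move=> Qw; rewrite -QE.
Qed.
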